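(* Let $m\ge2$ be an integer. Assume that, for every $1\le i\le m$, the sequence of functions $\{\phi_{m,n}^{i}\}_{n\ge1}$ converges uniformly on $[0,1]$ to a function $Y_m^i$ that is continuous on $[0,1]$ and differentiable on $(0,1]$. Let $\mathbf{k}_n^m$ be the optimal threshold, and let $\vartheta_m$ be the (unique) solution in $[0,1]$ of the equation $x=Y_m^m(x)$. Then $$\lim_{n\to\infty}\frac{\mathbf{k}_n^m}{n}=\vartheta_m.$$
   Context: Multi-returning secretary problem: there are $n$ candidates with a strict total ranking, and each candidate has $m$ identical copies, so there are $mn$ objects. The objects are inspected one by one in uniformly random order (all $(mn)!$ orders equally likely). When an object is inspected we learn which already inspected candidate it is a copy of (if any) and how its candidate ranks relative to all candidates inspected so far, and we must immediately accept it (the process ends) or reject it irrevocably. Success means accepting a copy of the best of the $n$ candidates. A strategy decides using only the information available so far; it is optimal if it maximizes the probability of success. At any moment the maximal candidate is the best among the candidates inspected so far. An inspected object is a nice candidate if it is the $m$-th (last) copy to appear of the candidate that is maximal at that moment. The process is in state $(k,i)$ if all objects inspected so far have been rejected, exactly $k$ different candidates have been inspected, and exactly $i$ copies of the maximal candidate among them have been inspected. For $1\le k\le n$ and $1\le i\le m$: $\Psi_{m,n}^{i}(k)$ is the probability of success when, starting from state $(k,i)$, one follows an optimal strategy from then on; $\Phi_{m,n}^{i}(k)$ is the probability of success when, starting from state $(k,i)$, one accepts the first nice candidate inspected from then on. The optimal threshold is $\mathbf{k}_n^m:=\min\{k\in\{1,\dots,n\}: k/n\ge\Psi_{m,n}^{m}(k)\}$.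 For $x\in[0,1]$, $\phi_{m,n}^{i}(x):=\Phi_{m,n}^{i}(\lfloor xn\rfloor)$, with the convention $\Phi_{m,n}^{i}(0):=\Phi_{m,n}^{i}(1)$. In the paper the functions $y_i=Y_m^i$ are denoted as the solutions on $(0,1]$ of the following system with $y_i(1)=1$ for $1\le i\le m-1$ and $y_m(1)=0$ (which the uniform limits of $\phi_{m,n}^i$ satisfy): $$\begin{cases} (m-mx)\,y_1'=(m-1)y_1-(m-1)y_2 & (\text{if } m\ge3),\\ (mx-mx^2)\,y_i'=m(x-1)y_1+(m-ix)y_i-x(m-i)y_{i+1}, & 2\le i\le m-2,\\ (mx-mx^2)\,y_{m-1}'=-(m-mx)y_1+(m-(m-1)x)y_{m-1}-x^2,\\ x\,y_m'=-y_1+y_m. \end{cases}$$ *)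

(* Defs.v *)
From mathcomp Require Import all_boot all_order all_algebra.
From mathcomp Require Import all_classical all_reals all_analysis.

Set Implicit Arguments.
Unset Strict Implicit.
Unset Printing Implicit Defensive.

Import Order.TTheory GRing.Theory Num.Theory.
Import numFieldNormedType.Exports.

Local Open Scope classical_set_scope.
Local Open Scope ring_scope.

(* Candidates are identified with their ranks: candidate [c : 'I_n] is better
   than [d] iff [d < c], so the best one is [n.-1].  The object [(c, j)] is the
   [j]-th copy of [c]; [j] only serves to count the orders and is never
   observed. *)
Definition orders (m n : nat) : {set (m * n)%N.-tuple ('I_n * 'I_m)} :=
  [set w : (m * n)%N.-tuple ('I_n * 'I_m) | uniq w]%SET.

Definition cands (m n : nat) (w : seq ('I_n * 'I_m)) : seq nat :=
  [seq val o.1 | o <- w].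

(* What has been learnt from the inspected sequence [s]: the entry at each time
   is the rank of the candidate inspected then among the distinct candidates
   of [s].  Hence [obs s = obs s'] iff [s] and [s'] have the same length and the
   same pattern of equalities and comparisons; the observation at a given time
   determines all the earlier ones. *)
Definition obs (s : seq nat) : seq nat :=
  [seq count (fun y => (y < x)%N) (undup s) | x <- s].

(* [sigma h] tells whether to accept the last inspected object when the
   observation, that object included, is [h]. *)
Definition strategy := seq nat -> bool.

Definition maximal (s : seq nat) : nat := (\max_(x <- s) x)%N.

(* Invariant under [obs], so this is also the strategy that accepts every nice
   candidate. *)
Definition nice (m : nat) : strategy := fun h =>
  [&& (0 < size h)%N, last 0%N h == maximal h & count_mem (maximal h) h == m].

(* The state, apart from the requirement that all of [s] has been rejected,
   which is built into [wins] below. *)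
Definition in_state (k i : nat) (s : seq nat) : bool :=
  (size (undup s) == k) && (count_mem (maximal s) s == i).

Definition state_at (k i : nat) (s : seq nat) (t : nat) : bool :=
  in_state k i (take t s).

(* First number of inspections after which the state is [(k, i)];
   [(size s).+1] if there is none. *)
Definition entry (k i : nat) (s : seq nat) : nat :=
  find (state_at k i s) (iota 0 (size s).+1).

Definition visiting (m n k i : nat) : {set (m * n)%N.-tuple ('I_n * 'I_m)} :=
  [set w in orders m n
    | has (state_at k i (cands w)) (iota 0 (size (cands w)).+1)]%SET.

(* Reject the first [t0] objects, then apply [sigma]; [nth 0 s t] is the object
   inspected at time [t.+1]. *)
Definition wins (n : nat) (sigma : strategy) (s : seq nat) (t0 : nat) : bool :=
  if [seq t <- iota t0 (size s - t0) | sigma (obs (take t.+1 s))] is t :: _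
  then nth 0%N s t == n.-1 else false.

Definition winning (m n k i : nat) (sigma : strategy) :
    {set (m * n)%N.-tuple ('I_n * 'I_m)} :=
  [set w in visiting m n k i
    | wins n sigma (cands w) (entry k i (cands w))]%SET.

(* Probability of success of [sigma] applied from the moment the state [(k, i)]
   is entered, conditionally on that state being entered when everything is
   rejected before. *)
Definition success (R : realType) (m n k i : nat) (sigma : strategy) : R :=
  #|winning m n k i sigma|%:R / #|visiting m n k i|%:R.

(* The supremum is a maximum, see [Psi_attained]. *)
Definition Psi (R : realType) (m n i k : nat) : R :=
  sup [set success R m n k i sigma | sigma in [set: strategy]].

Definition Phi (R : realType) (m n i k : nat) : R :=
  success R m n k i (nice m).

(* [Num.truncn] is the floor on nonnegative reals; [maxn 1] is the convention
   [Phi 0 := Phi 1]. *)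
Definition phi (R : realType) (m i n : nat) (x : R) : R :=
  Phi R m n i (maxn 1 (Num.truncn (x * n%:R))).

(* A minimum over a nonempty set when [0 < n], since [n] satisfies the
   condition; the default value [n] plays no role then. *)
Definition threshold (R : realType) (m n : nat) : nat :=
  (\big[minn/n]_(1 <= k < n.+1 | (Psi R m n m k <= k%:R / n%:R)%R) k)%N.

(* Derivability relative to [A]: one-sided at the end points of an interval. *)
Definition derivable_on (R : realType) (A : set R) (f : R -> R) : Prop :=
  forall x, A x -> cvg ((f y - f x) / (y - x) @[y --> within A x^']).

Lemma Psi_attained (R : realType) (m n i k : nat) :
  exists sigma : strategy, Psi R m n i k = success R m n k i sigma /\
    forall tau : strategy, success R m n k i tau <= success R m n k i sigma.
Proof.
pose P j := `[< exists sigma, #|winning m n k i sigma| = j >].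
have exP : exists j, P j.
  by exists #|winning m n k i (nice m)|; apply/asboolP; exists (nice m).
have leP j : P j -> (j <= #|visiting m n k i|)%N.
  move=> /asboolP[sigma <-]; apply: subset_leq_card.
  by apply/fintype.subsetP => w; rewrite inE => /andP[].
case: (ex_maxnP exP leP) => j /asboolP[sigma sigmaj] jmax.
have smax tau : success R m n k i tau <= success R m n k i sigma.
  rewrite ler_wpM2r ?invr_ge0// ler_nat sigmaj.
  by apply: jmax; apply/asboolP; exists tau.
exists sigma; split => //; apply/eqP; rewrite eq_le; apply/andP; split.
  by apply: ge_sup => [|_ [tau _ <-]]; [exists (success R m n k i sigma), sigma|].
apply: ub_le_sup; last by exists sigma.
by exists (success R m n k i sigma) => _ [tau _ <-].
Qed.

Lemma threshold_min (R : realType) (m n : nat) : (0 < n)%N ->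
  [/\ (1 <= threshold R m n <= n)%N,
      Psi R m n m (threshold R m n) <= (threshold R m n)%:R / n%:R &
      forall k, (1 <= k <= n)%N -> Psi R m n m k <= k%:R / n%:R ->
        (threshold R m n <= k)%N].
Proof.
move=> n0.
have Pn : Psi R m n m n <= n%:R / n%:R.
  have [sigma [-> _]] := Psi_attained R m n m n; rewrite /success.
  rewrite divff ?pnatr_eq0 -?lt0n//.
  have [->|V0] := posnP #|visiting m n n m|; first by rewrite invr0 mulr0.
  rewrite ler_pdivrMr ?ltr0n// mul1r ler_nat subset_leq_card//.
  by apply/fintype.subsetP => w; rewrite inE => /andP[].
split.
- rewrite /threshold big_nat_cond.
  apply: (big_ind (fun k => 1 <= k <= n)%N) => [|a b|k /andP[/andP[-> //]]].
  + by rewrite n0 leqnn.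
  + by rewrite /minn; case: ifP.
- rewrite /threshold.
  apply: (big_ind (fun k => Psi R m n m k <= k%:R / n%:R)) => // a b.
  by rewrite /minn; case: ifP.
move=> k kn Pk; rewrite /threshold.
have : k \in index_iota 1 n.+1 by rewrite mem_index_iota ltnS.
elim: (index_iota 1 n.+1) => // a l IH; rewrite big_cons inE.
case/predU1P => [<-|/IH kl]; first by rewrite Pk geq_minl.
by case: ifP => // _; rewrite geq_min kl orbT.
Qed.

(* Main.v *)
Require Import Defs.
From mathcomp Require Import all_boot all_order all_algebra.
From mathcomp Require Import all_classical all_reals all_analysis.
From mathcomp Require Import perm zify ring lra.

(* Given the observation of the first [t] objects, the rank of a new candidate
   is uniform and the next object is equally likely to be any remaining one, so
   the values of states satisfy an explicit recursion.  Backward induction on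
   the length of the history shows that it computes [Phi], and that no strategy
   does better from [(k, m)] as soon as [Phi l <= l / n] for all [l >= k], where
   [Phi l] is the value of [(l, m)].
     With [c = m / (m + 1)], the value of [(k, 1)] is at least [c] and the
   recursion makes [(Phi k - c) / k] nonincreasing in [k]; hence so is
   [Phi k / k], and the threshold is the least [k] with [Phi k <= k / n].  In
   the limit [(Y x - c) / x] is nonincreasing and [Y 1 = 0], so [Y 0 >= c > 0]
   and the graph of [Y] crosses the diagonal exactly once, from above to below,
   which determines the limit of the threshold. *)

Set Implicit Arguments.
Unset Strict Implicit.
Unset Printing Implicit Defensive.

Import Order.TTheory GRing.Theory Num.Theory.
Import numFieldNormedType.Exports.

Local Open Scope nat_scope.

(** * Ranks and observations *)

(** Also applied to an [x] outside [s], where it is the rank that [x] would receive as a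
    newcomer. *)
Definition rank (s : seq nat) (x : nat) : nat :=
  count (fun y => y < x) (undup s).

Lemma obsE s : obs s = [seq rank s x | x <- s].
Proof. by []. Qed.

Lemma rank_lt s x y : x \in s -> x < y -> rank s x < rank s y.
Proof.
move=> xs xy; rewrite /rank.
have -> : count (fun z => z < y) (undup s) =
    count (fun z => z < x) (undup s) + count (fun z => x <= z < y) (undup s).
  rewrite -count_predUI [X in _ + X](@eq_count _ _ pred0) ?count_pred0 ?addn0 => [|z] /=; last by lia.
  by apply: eq_count => z /=; lia.
rewrite -[X in X < _]addn0 ltn_add2l -has_count; apply/hasP; exists x.
  by rewrite mem_undup.
by rewrite leqnn.
Qed.

Lemma rank_mono s : {in s &, {mono rank s : x y / x < y}}.
Proof.
move=> x y xs ys; case: (ltngtP x y) => [xy|yx|->]; last by rewrite ltnn.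
  by rewrite rank_lt.
by apply/negbTE; rewrite -leqNgt ltnW// rank_lt.
Qed.

Lemma rank_ltn_size s x : x \in s -> rank s x < size (undup s).
Proof.
move=> xs; rewrite /rank -(count_predC (fun y => y < x) (undup s)).
rewrite -[X in X < _]addn0 ltn_add2l -has_count; apply/hasP; exists x.
  by rewrite mem_undup.
by rewrite /= ltnn.
Qed.

Lemma rank_leq_size s x : rank s x <= size (undup s).
Proof. exact: count_size. Qed.

Lemma rank_inj s : {in s &, injective (rank s)}.
Proof.
move=> x y xs ys e; have := rank_mono xs ys; have := rank_mono ys xs.
by rewrite e ltnn; lia.
Qed.

Lemma eq_rank s s' : s =i s' -> rank s =1 rank s'.
Proof. by move=> e x; have /seq.permP pe := perm_undup e; apply: pe. Qed.

Lemma size_obs s : size (obs s) = size s.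
Proof. by rewrite size_map. Qed.

(** Such sequences are exactly the observations: [obs_ranked] gives one direction and [obs_id] the
    other. *)
Definition ranked (k : nat) (h : seq nat) : Prop :=
  forall x, (x \in h) = (x < k).

Lemma ranked_perm k h : ranked k h -> perm_eq (undup h) (iota 0 k).
Proof.
move=> hk; apply: uniq_perm; rewrite ?undup_uniq ?iota_uniq// => x.
by rewrite mem_undup hk mem_iota add0n.
Qed.

Lemma ranked_size k h : ranked k h -> size (undup h) = k.
Proof. by move=> /ranked_perm/perm_size ->; rewrite size_iota. Qed.

Lemma ranked_maximal k h : 0 < k -> ranked k h -> maximal h = k.-1.
Proof.
move=> k0 hk; rewrite /maximal; apply/eqP; rewrite eqn_leq; apply/andP; split.
  by apply/bigmax_leqP_seq => x; rewrite hk => + _; lia.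
have kh : k.-1 \in h by rewrite hk; lia.
exact: (@leq_bigmax_seq _ h xpredT id _ kh).
Qed.

Lemma rank_ranked k h x : ranked k h -> x <= k -> rank h x = x.
Proof.
move=> /ranked_perm hk xk; rewrite /rank (seq.permP hk) -size_filter.
rewrite (eq_filter (a2 := fun y => 0 <= y < 0 + x))//.
have -> : iota 0 k = iota 0 x ++ iota x (k - x) by rewrite -iotaD; congr iota; lia.
rewrite filter_cat size_cat !size_filter.
rewrite (@eq_in_count _ _ xpredT (iota 0 x)); last by move=> y; rewrite mem_iota => ->.
rewrite (@eq_in_count _ _ pred0 (iota x _)); last by move=> y; rewrite mem_iota /=; lia.
by rewrite count_predT count_pred0 addn0 size_iota.
Qed.

(** The ranks of the distinct entries are distinct and below [size (undup s)], so by counting they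
    fill that range. *)
Lemma obs_ranked s : ranked (size (undup s)) (obs s).
Proof.
have su : uniq (map (rank s) (undup s)).
  rewrite map_inj_in_uniq ?undup_uniq// => y z; rewrite !mem_undup => ys zs.
  exact: rank_inj.
have sub : {subset map (rank s) (undup s) <= iota 0 (size (undup s))}.
  move=> _ /mapP[y ys ->]; rewrite mem_iota /= add0n.
  by apply: rank_ltn_size; rewrite mem_undup in ys.
have [|_ e x] := uniq_min_size su sub; first by rewrite size_iota size_map.
have := e x; rewrite mem_iota /= add0n => <-; rewrite obsE.
by apply/mapP/mapP => -[y ys ->]; exists y; rewrite ?mem_undup in ys *.
Qed.

Lemma obs_map g h : {in h &, {mono g : x y / x < y}} -> obs (map g h) = obs h.
Proof.
move=> gm; have gi : {in h &, injective g}.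
  move=> x y xh yh e; have := gm _ _ xh yh; have := gm _ _ yh xh.
  by rewrite e ltnn; lia.
rewrite !obsE -map_comp; apply/eq_in_map => x xh /=; rewrite /rank.
have -> : count (fun y => y < g x) (undup (map g h)) =
          count (fun y => y < g x) (map g (undup h)).
  apply/seq.permP/uniq_perm; rewrite ?undup_uniq ?map_inj_in_uniq ?undup_uniq//.
    by move=> y z; rewrite !mem_undup; apply: gi.
  move=> z; rewrite mem_undup.
  by apply/mapP/mapP => -[y yh ->]; exists y; rewrite ?mem_undup// -mem_undup.
rewrite count_map; apply: eq_in_count => y; rewrite mem_undup => yh /=.
exact: gm.
Qed.

Lemma obs_id k h : ranked k h -> obs h = h.
Proof.
move=> hk; rewrite obsE -[RHS]map_id; apply/eq_in_map => x.
by rewrite hk => xk; rewrite (rank_ranked hk)// ltnW.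
Qed.

(** The rank of an entry is its index in the sorted list of distinct entries; hence the observation
    and the set of entries together determine the sequence. *)
Lemma lift_obs s : s = [seq nth 0 (sort leq (undup s)) x | x <- obs s].
Proof.
rewrite obsE -map_comp -[LHS]map_id; apply/eq_in_map => x xs /=.
set e := sort leq (undup s).
have xe : x \in e by rewrite mem_sort mem_undup.
suff -> : rank s x = index x e by rewrite nth_index.
have ie := index_mem x e; rewrite xe in ie.
rewrite /rank -(seq.permP (permEl (perm_sort leq _))) -/e.
have se : sorted ltn e.
  by rewrite ltn_sorted_uniq_leq// sort_uniq undup_uniq sort_sorted//; exact: leq_total.
rewrite -[X in count _ X](cat_take_drop (index x e)) count_cat.
rewrite (@eq_in_count _ _ xpredT (take _ _)) ?(@eq_in_count _ _ pred0 (drop _ _)).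
- by rewrite count_predT count_pred0 addn0 size_take ie.
- move=> y /(nthP 0)[j]; rewrite size_drop nth_drop /= => je <-.
  apply/negbTE; rewrite -leqNgt -[X in X <= _](nth_index 0 xe).
  have sl : sorted leq e by rewrite sort_sorted//; exact: leq_total.
  by apply: (sorted_leq_nth leq_trans leqnn 0 sl); rewrite ?inE ?leq_addr -?ltn_subRL.
- move=> y /(nthP 0)[j]; rewrite size_take ie => je; rewrite nth_take// => <- /=.
  rewrite -[X in _ < X](nth_index 0 xe).
  by apply: (sorted_ltn_nth ltn_trans 0 se); rewrite ?inE// (ltn_trans je).
Qed.

Lemma obs_rcons_old s c : c \in s -> obs (rcons s c) = rcons (obs s) (rank s c).
Proof.
move=> cs; have e : rcons s c =i s.
  by move=> x; rewrite mem_rcons inE; case: eqP => // ->; rewrite cs.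
by rewrite !obsE (eq_map (eq_rank e)) map_rcons.
Qed.

(** A newcomer of rank [r] raises by one every rank that is at least [r], which is what [bump r]
    does. *)
Lemma obs_rcons_new s c : c \notin s ->
  obs (rcons s c) = rcons [seq bump (rank s c) x | x <- obs s] (rank s c).
Proof.
move=> cs; rewrite !obsE map_rcons.
have rE x : rank (rcons s c) x = (c < x) + rank s x.
  rewrite (@eq_rank _ (c :: s)) => [|y]; last by rewrite mem_rcons.
  by rewrite /rank /= (negbTE cs).
rewrite rE ltnn add0n; congr rcons; rewrite -map_comp; apply/eq_in_map => x xs /=.
rewrite rE /bump; congr (nat_of_bool _ + _).
case: (ltngtP c x) => [cx|xc|e]; last by rewrite e xs in cs.
- by apply/esym/sub_count => y /= yc; apply: ltn_trans cx.
- by apply/esym/negbTE; rewrite -ltnNge rank_lt.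
Qed.

Lemma ranked_old k h j : ranked k h -> j < k -> ranked k (rcons h j).
Proof.
by move=> hk jk x; rewrite mem_rcons inE hk; case: eqP => // ->; rewrite jk.
Qed.

Lemma ranked_new k h r : ranked k h -> r <= k ->
  ranked k.+1 (rcons (map (bump r) h) r).
Proof.
move=> hk rk x; rewrite mem_rcons inE; apply/predU1P/idP => [[->|/mapP[y]]|xk].
- by [].
- by rewrite hk => yk ->; rewrite /bump; lia.
- case: (eqVneq x r) => [->|xr]; [by left|right]; apply/mapP; exists (unbump r x).
    by rewrite hk /unbump; lia.
  by rewrite unbumpKcond/=; lia.
Qed.

(** * Counting orders *)

Section Orders.
Context (m n : nat).
Notation T := (m * n).
Implicit Types (w : T.-tuple ('I_n * 'I_m)) (s h : seq nat).

Definition prefixed s : {set T.-tuple ('I_n * 'I_m)} :=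
  [set w in orders m n | take (size s) (cands w) == s]%SET.

Definition observing h : {set T.-tuple ('I_n * 'I_m)} :=
  [set w in orders m n | obs (take (size h) (cands w)) == h]%SET.

Lemma size_cands w : size (cands w) = T.
Proof. by rewrite size_map size_tuple. Qed.

Lemma cands_ltn w c : c \in cands w -> c < n.
Proof. by rewrite /cands => /mapP[q _ ->]; apply: ltn_ord. Qed.

(** An order consists of [m * n] distinct objects, so it is a permutation of all of them. *)
Lemma count_cands w c : w \in orders m n -> c < n -> count_mem c (cands w) = m.
Proof.
rewrite inE => uw cn; rewrite /cands count_map.
have wT : perm_eq w (enum {: 'I_n * 'I_m}).
  apply: uniq_perm; rewrite ?enum_uniq// => o; rewrite mem_enum inE.
  have/subset_cardP/(_ (subset_predT _)) wE : #|w| = #|{: 'I_n * 'I_m}|.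
    by rewrite (card_uniqP uw) size_tuple card_prod !card_ord mulnC.
  by rewrite wE.
rewrite (seq.permP wT) -size_filter enumT.
transitivity #|finset.setX [set Ordinal cn]%SET [set: 'I_m]%SET|.
  rewrite cardE; congr size; apply: eq_filter => o.
  by rewrite /= !inE andbT.
by rewrite cardsX cards1 cardsT card_ord mul1n.
Qed.

Lemma mem_prefixed s w : (w \in prefixed s) =
  (w \in orders m n) && (take (size s) (cands w) == s).
Proof. by rewrite finset.in_set. Qed.

Lemma mem_observing h w : (w \in observing h) =
  (w \in orders m n) && (obs (take (size h) (cands w)) == h).
Proof. by rewrite finset.in_set. Qed.

Lemma prefixed_rcons s c w : size s < T -> (w \in prefixed (rcons s c)) =
  (w \in prefixed s) && (nth 0 (cands w) (size s) == c).
Proof.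
move=> sT; rewrite !mem_prefixed -andbA size_rcons (take_nth 0) ?size_cands//.
by rewrite eqseq_rcons.
Qed.

Definition swapt (t u : 'I_T) w : T.-tuple ('I_n * 'I_m) :=
  [tuple tnth w (tperm t u i) | i < T].

Lemma swaptK t u : involutive (swapt t u).
Proof. by move=> w; apply/eq_from_tnth => i; rewrite !tnth_mktuple tpermK. Qed.

Lemma swapt_orders t u w : (swapt t u w \in orders m n) = (w \in orders m n).
Proof.
suff sub w' : w' \in orders m n -> swapt t u w' \in orders m n.
  by apply/idP/idP => [/sub|]; [rewrite swaptK|exact: sub].
rewrite !inE => uw; rewrite map_inj_in_uniq ?enum_uniq// => i j _ _.
by move=> /(tuple_uniqP _ uw)/perm_inj.
Qed.

Lemma nth_swapt (t u i : 'I_T) w :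
  nth 0 (cands (swapt t u w)) i = nth 0 (cands w) (tperm t u i).
Proof.
have E (v : T.-tuple ('I_n * 'I_m)) (j : 'I_T) : nth 0 (cands v) j = val (tnth v j).1.
  by rewrite /cands (nth_map (tnth v j)) ?size_tuple// -tnth_nth.
by rewrite !E tnth_mktuple.
Qed.

(** Exchanging the positions [size s] and [u] is an involution on orders, and it keeps the first
    [size s] entries because both positions lie beyond them. *)
Lemma card_prefixed_at s c u : size s <= u < T ->
  #|[set w in prefixed s | nth 0 (cands w) u == c]%SET| = #|prefixed (rcons s c)|.
Proof.
move=> /andP[su uT]; have sT := leq_ltn_trans su uT.
pose t' := Ordinal sT; pose u' := Ordinal uT.
have bij : {on prefixed (rcons s c), bijective (swapt t' u')}.
  by apply: onW_bij; exists (swapt t' u'); exact: swaptK.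
rewrite -(on_card_preimset bij); apply: eq_card => w.
rewrite [RHS]finset.in_set prefixed_rcons// finset.in_set !mem_prefixed swapt_orders.
rewrite (nth_swapt t' u' t') tpermL -!andbA; congr [&& _, _ == _ & _].
apply: (@eq_from_nth _ 0) => [|i]; rewrite !size_take !size_cands sT// => iS.
rewrite !nth_take//; have iT := ltn_trans iS sT.
rewrite (nth_swapt t' u' (Ordinal iT)) tpermD//.
  by rewrite -val_eqE /=; lia.
by rewrite -val_eqE /=; lia.
Qed.

(* Exchanging two positions shows that candidate [c] is equally likely to occur
   at each position after [s]; it occurs [m - count_mem c s] times there. *)
Lemma card_prefixed_rcons s c : c < n ->
  (T - size s) * #|prefixed (rcons s c)| = (m - count_mem c s) * #|prefixed s|.
Proof.
move=> cn; transitivity (\sum_(size s <= u < T)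
    #|[set w in prefixed s | nth 0 (cands w) u == c]%SET|).
  rewrite -sum_nat_const_nat big_nat_cond [RHS]big_nat_cond.
  by apply: eq_bigr => u /andP[su _]; rewrite card_prefixed_at.
transitivity (\sum_(w in prefixed s) \sum_(size s <= u < T)
    (nth 0 (cands w) u == c)).
  rewrite exchange_big/=; apply: eq_bigr => u _.
  rewrite -sum1_card big_mkcond [RHS]big_mkcond/=; apply: eq_bigr => w _.
  by rewrite finset.in_set; case: (w \in _); case: (_ == _).
rewrite [RHS]mulnC -sum_nat_const; apply: eq_bigr => w.
rewrite mem_prefixed => /andP[wo /eqP ws].
have -> : m - count_mem c s = count_mem c (drop (size s) (cands w)).
  have := count_cands wo cn; rewrite -{1}(cat_take_drop (size s) (cands w)).
  by rewrite count_cat ws; lia.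
rewrite -sum1_count.
rewrite -(take_size (drop _ _)) size_drop size_cands.
rewrite -(@map_nth_iota _ 0) ?size_cands// big_map.
by rewrite [RHS]big_mkcond /index_iota; apply: eq_bigr => u _ /=; case: eqP.
Qed.


(** The ratios in [card_prefixed_rcons] involve only multiplicities, so the number of orders with a
    given prefix depends only on the pattern of equalities in it. *)
Lemma card_prefixed_map (g g' : nat -> nat) h : size h <= T ->
  {in h &, injective g} -> {in h &, injective g'} ->
  {in h, forall x, g x < n} -> {in h, forall x, g' x < n} ->
  #|prefixed (map g h)| = #|prefixed (map g' h)|.
Proof.
elim/last_ind: h => [//|h c IH]; rewrite size_rcons => hT gi g'i gn g'n.
have ch : c \in rcons h c by rewrite mem_rcons mem_head.
have hh x : x \in h -> x \in rcons h c by rewrite mem_rcons inE orbC => ->.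
have cnt (f : nat -> nat) : {in rcons h c &, injective f} ->
    count_mem (f c) (map f h) = count_mem c h.
  move=> fi; rewrite count_map; apply: eq_in_count => x xh /=.
  by apply/eqP/eqP => [/(fi _ _ (hh _ xh) ch)|->].
have := card_prefixed_rcons (map g h) (gn _ ch).
have := card_prefixed_rcons (map g' h) (g'n _ ch).
rewrite !size_map -!map_rcons !cnt// IH 1?ltnW//.
- by move=> <- /eqP; rewrite eqn_pmul2l ?subn_gt0// => /eqP.
- by move=> x y xh yh; apply: gi; apply: hh.
- by move=> x y xh yh; apply: g'i; apply: hh.
- by move=> x xh; apply: gn; apply: hh.
- by move=> x xh; apply: g'n; apply: hh.
Qed.

(** By [card_prefixed_rcons] the count stays positive as long as each appended candidate still has a
    copy left. *)
Lemma prefixed_gt0 s : {in s, forall x, x < n} ->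
  (forall x, count_mem x s <= m) -> 0 < #|prefixed s|.
Proof.
elim/last_ind: s => [|s c IH] sn sm.
  have szT : size (enum {: 'I_n * 'I_m}) == T.
    by rewrite -cardE card_prod !card_ord mulnC.
  apply/card_gt0P; exists (Tuple szT).
  by rewrite mem_prefixed take0 eqxx andbT inE /= enum_uniq.
have F0 : 0 < #|prefixed s|.
  apply: IH => x; last by apply: leq_trans (sm x); rewrite -cats1 count_cat leq_addr.
  by move=> xs; apply: sn; rewrite mem_rcons inE xs orbT.
have cn : c < n by apply: sn; rewrite mem_rcons mem_head.
have cm : count_mem c s < m.
  by have := sm c; rewrite -cats1 count_cat /= eqxx addn0 addn1.
have := card_prefixed_rcons s cn.
by case: #|prefixed (rcons s c)| => // /eqP; rewrite muln0 eq_sym muln_eq0 subn_eq0 leqNgt cm/= eqn0Ngt F0.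
Qed.

(** * The set of candidates inspected so far *)

Definition seen (t : nat) w : {set 'I_n} :=
  [set c : 'I_n | val c \in take t (cands w)]%SET.

Definition sub_enum (B : {set 'I_n}) : seq nat := map val (enum B).

Lemma sub_enum_sorted B : sorted ltn (sub_enum B).
Proof.
apply: (subseq_sorted ltn_trans) (iota_ltn_sorted 0 n).
by rewrite -val_enum_ord /sub_enum {1}/enum_mem -enumT; apply/map_subseq/filter_subseq.
Qed.

Lemma mem_sub_enum B (c : 'I_n) : (val c \in sub_enum B) = (c \in B).
Proof. by rewrite mem_map ?mem_enum//; exact: val_inj. Qed.

Lemma size_sub_enum B : size (sub_enum B) = #|B|.
Proof. by rewrite size_map -cardE. Qed.

Lemma sub_enum_seen t w :
  sub_enum (seen t w) = sort leq (undup (take t (cands w))).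
Proof.
apply: (irr_sorted_eq ltn_trans ltnn); first exact: sub_enum_sorted.
  by rewrite ltn_sorted_uniq_leq sort_uniq undup_uniq sort_sorted//; exact: leq_total.
move=> x; rewrite mem_sort mem_undup; apply/mapP/idP => [[c]|xs].
  by rewrite mem_enum inE => cs ->.
have xn : x < n by apply: (@cands_ltn w); exact: mem_take xs.
by exists (Ordinal xn); rewrite ?mem_enum ?inE.
Qed.

(** Once the set [B] of inspected candidates is fixed, an observation amounts to a prefix: the entry
    [x] of [h] stands for the member of [B] of rank [x]. *)
Lemma observing_seen k h (B : {set 'I_n}) : ranked k h -> #|B| = k ->
  [set w in observing h | seen (size h) w == B]%SET =
  prefixed [seq nth 0 (sub_enum B) x | x <- h].
Proof.
move=> hk Bk; apply/setP => w.
rewrite finset.in_set mem_observing mem_prefixed size_map -andbA.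
congr andb; apply/andP/eqP => [[/eqP hE /eqP <-]|hE].
  by rewrite sub_enum_seen {1}[LHS]lift_obs hE.
have gm : {in h &, {mono nth 0 (sub_enum B) : x y / x < y}}.
  move=> x y; rewrite !hk -Bk -size_sub_enum => xk yk.
  have H := sorted_ltn_nth ltn_trans 0 (sub_enum_sorted B).
  case: (ltngtP x y) => [xy|yx|->]; last by rewrite ltnn.
    by apply: H.
  by apply/negbTE; rewrite -leqNgt ltnW//; apply: H.
split; first by rewrite hE obs_map// (obs_id hk).
apply/eqP/setP => c; rewrite inE hE -mem_sub_enum; apply/mapP/idP => [[x xh ->]|cB].
  by rewrite mem_nth// size_sub_enum Bk -hk.
exists (index (val c) (sub_enum B)); last by rewrite nth_index.
by rewrite hk -Bk -size_sub_enum index_mem.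
Qed.

Lemma card_seen t w : #|seen t w| = size (undup (take t (cands w))).
Proof. by rewrite -size_sub_enum sub_enum_seen size_sort. Qed.

Lemma observing_size k h w : ranked k h -> w \in observing h ->
  size (undup (take (size h) (cands w))) = k.
Proof.
move=> hk; rewrite mem_observing => /andP[_ /eqP hE].
have := obs_ranked (take (size h) (cands w)); rewrite hE => /ranked_size <-.
exact: ranked_size.
Qed.

(** Every [k]-subset accounts for equally many orders, by [card_prefixed_map]: given the
    observation, the set of inspected candidates is uniform. *)
Lemma card_observing_seen k h (Q : pred {set 'I_n}) : ranked k h -> size h <= T ->
  #|[set w in observing h | Q (seen (size h) w)]%SET| =
  #|[set B : {set 'I_n} | (#|B| == k) && Q B]%SET| * #|prefixed h|.
Proof.
move=> hk hT; rewrite -sum1_card.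
rewrite (partition_big (seen (size h)) (fun B : {set 'I_n} => (#|B| == k) && Q B))/=; last first.
  move=> w; rewrite finset.in_set => /andP[wh ->].
  by rewrite card_seen (observing_size hk wh) eqxx.
rewrite -sum_nat_const; apply: eq_big => [B|B /andP[/eqP Bk QB]].
  by rewrite finset.in_set.
transitivity #|[set w in observing h | seen (size h) w == B]%SET|.
  rewrite -sum1_card; apply: eq_bigl => w.
  by rewrite !finset.in_set -andbA; congr andb; case: eqP => [->|]; rewrite ?QB ?andbF.
rewrite (observing_seen hk Bk) -[h in RHS]map_id; apply: card_prefixed_map => //.
- move=> x y; rewrite !hk -Bk -size_sub_enum => xk yk /eqP.
  rewrite nth_uniq//; first by move/eqP.
  exact: (sorted_uniq ltn_trans ltnn (sub_enum_sorted B)).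
- move=> x; rewrite hk -Bk -size_sub_enum => xk.
  by have /mapP[c _ ->] := mem_nth 0 xk; exact: ltn_ord.
- by move=> x; rewrite hk -Bk => xk; apply: leq_trans xk _; rewrite -[n in _ <= n]card_ord max_card.
Qed.

Lemma card_observing k h : ranked k h -> size h <= T ->
  #|observing h| = 'C(n, k) * #|prefixed h|.
Proof.
move=> hk hT; have := card_observing_seen predT hk hT.
rewrite (_ : [set _ in _ | _]%SET = observing h); last first.
  by apply/setP => w; rewrite finset.in_set andbT.
move=> ->; congr (_ * _); rewrite -[X in 'C(X, _)](card_ord n) -card_draws.
by apply: eq_card => B; rewrite !finset.in_set andbT.
Qed.

(** The last object, being maximal so far, is best overall iff the best candidate lies in the
    uniform [k]-subset of inspected candidates; this has probability [k / n]. *)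
Lemma card_observing_best k h : 0 < k -> 0 < n -> ranked k h -> size h <= T ->
  last 0 h = k.-1 ->
  n * #|[set w in observing h | nth 0 (cands w) (size h).-1 == n.-1]%SET| =
  k * #|observing h|.
Proof.
move=> k0 n0 hk hT hl; have n1 : n.-1 < n by rewrite prednK.
have h0 : 0 < size h.
  by case: h hk {hT hl} => // /(_ 0); rewrite k0.
pose Q (B : {set 'I_n}) := Ordinal n1 \in B.
transitivity (n * #|[set w in observing h | Q (seen (size h) w)]%SET|).
  congr (n * _); apply: eq_card => w; rewrite finset.in_set [RHS]finset.in_set.
  case: (boolP (w \in observing h)) => //= wh; rewrite /Q finset.in_set /=.
  have wk := observing_size hk wh.
  move: wh; rewrite mem_observing => /andP[_ /eqP wh].
  set s := take _ _ in wk wh *.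
  have ss : size s = size h by rewrite /s size_takel// size_cands.
  have -> : nth 0 (cands w) (size h).-1 = last 0 s.
    by rewrite -nth_last ss /s nth_take// prednK.
  have ls : last 0 s \in s.
    by case: (s) ss h0 => [<-//|x s'] _ _ /=; rewrite mem_last.
  have ln : last 0 s < n by apply: (@cands_ltn w); exact: mem_take ls.
  apply/idP/idP => [/eqP <- //|ns]; rewrite eqn_leq -ltnS prednK// ln/=.
  rewrite leqNgt; apply/negP => /(rank_lt ls); rewrite ltnNge => /negP; apply.
  have -> : rank s (last 0 s) = k.-1.
    by rewrite -hl -wh obsE; case: (s) ls => //= x s' _; rewrite last_map.
  by rewrite -ltnS prednK// -wk rank_ltn_size.
rewrite (card_observing_seen Q hk hT) (card_observing hk hT) !mulnA; congr (_ * _).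
(* Removing the subsets that avoid the best candidate leaves ['C(n.-1, k.-1)] by Pascal's rule, and
   [n * 'C(n.-1, k.-1) = k * 'C(n, k)]. *)
have : #|[set B : {set 'I_n} | #|B| == k]%SET| =
    #|[set B : {set 'I_n} | (#|B| == k) && Q B]%SET| +
    #|[set B : {set 'I_n} | B \subset ~: [set Ordinal n1] & #|B| == k]%SET|.
  rewrite -(cardsID [set B | Q B]%SET); congr (_ + _); apply: eq_card => B.
    by rewrite !inE.
  by rewrite !finset.in_set finset.subsetC finset.sub1set finset.in_set andbC.
rewrite card_draws cards_draws cardsC1 card_ord.
have := binS n.-1 k.-1; have := mul_bin_diag n k.-1.
rewrite !prednK// => bE bS /eqP; rewrite {1}bS addnC eqn_add2r => /eqP <-.
by rewrite bE.
Qed.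

End Orders.

(** * Histories and their one-step extensions *)

Definition newcomer (h : seq nat) (r : nat) : seq nat :=
  rcons (map (bump r) h) r.

Section Children.
Context (m n : nat).
Notation T := (m * n).
Implicit Types (w : T.-tuple ('I_n * 'I_m)) (s h : seq nat).

(** Among the [T - size h] remaining objects, [m - count_mem j h] are copies of the candidate of
    rank [j]. *)
Lemma card_observing_old k h j : ranked k h -> size h < T -> j < k ->
  (T - size h) * #|observing m n (rcons h j)| =
  (m - count_mem j h) * #|observing m n h|.
Proof.
move=> hk hT jk; have hjk := ranked_old hk jk.
rewrite (card_observing hjk) ?size_rcons// (card_observing hk) 1?ltnW//.
rewrite mulnCA [RHS]mulnCA; have [nk|kn] := ltnP n k; first by rewrite bin_small.
by rewrite card_prefixed_rcons// (leq_trans jk).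
Qed.

(** The remaining objects include [m * (n - k)] copies of uninspected candidates, and the rank of a
    newcomer is uniform over [k.+1] values. *)
Lemma card_observing_new k h r : ranked k h -> size h < T -> r <= k ->
  (T - size h) * (k.+1 * #|observing m n (newcomer h r)|) =
  m * (n - k) * #|observing m n h|.
Proof.
move=> hk hT rk; have hrk := ranked_new hk rk.
rewrite (card_observing hrk) ?size_rcons ?size_map//.
rewrite (card_observing hk) 1?ltnW// [k.+1 * _]mulnA mul_bin_left.
have [nk|kn] := leqP n k; first by rewrite (eqP nk) !mul0n !muln0.
have rn : r < n by lia.
rewrite mulnCA -[T - size h](congr1 (subn _) (size_map (bump r) h)).
rewrite card_prefixed_rcons// (_ : count_mem _ _ = 0) ?subn0; last first.
  by apply/count_memPn/mapP => -[x _ /eqP]; rewrite (negbTE (neq_bump r x)).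
rewrite -[in RHS](map_id h) (@card_prefixed_map _ _ (bump r) id).
- by rewrite -!mulnA; lia.
- exact: ltnW.
- by move=> x y _ _; apply: can_inj (bumpK r) _ _.
- by [].
- by move=> x; rewrite hk /bump => xk; lia.
- by move=> x; rewrite hk => xk; lia.
Qed.

(** The two kinds of extension cannot be confused: [j] already occurs in [h], whereas the rank [r]
    of a newcomer is avoided by [bump r]. *)
Lemma mem_observing_old k h j w : ranked k h -> size h < T -> j < k ->
  (w \in observing m n (rcons h j)) = [&& w \in observing m n h,
    nth 0 (cands w) (size h) \in take (size h) (cands w) &
    rank (take (size h) (cands w)) (nth 0 (cands w) (size h)) == j].
Proof.
move=> hk hT jk; rewrite !mem_observing -andbA size_rcons; congr andb.
rewrite (take_nth 0) ?size_cands//; set s := take _ _; set c := nth _ _ _.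
have [cs|cs] := boolP (c \in s); first by rewrite obs_rcons_old// eqseq_rcons.
rewrite obs_rcons_new// eqseq_rcons andbF; apply/negbTE/negP => /andP[/eqP e /eqP rj].
have : j \in h by rewrite hk.
by rewrite -e rj => /mapP[x _ /eqP]; rewrite (negbTE (neq_bump j x)).
Qed.

Lemma mem_observing_new h r w : size h < T ->
  (w \in observing m n (newcomer h r)) = [&& w \in observing m n h,
    nth 0 (cands w) (size h) \notin take (size h) (cands w) &
    rank (take (size h) (cands w)) (nth 0 (cands w) (size h)) == r].
Proof.
move=> hT; rewrite !mem_observing -andbA size_rcons size_map; congr andb.
rewrite (take_nth 0) ?size_cands//; set s := take _ _; set c := nth _ _ _.
have [cs|cs] := boolP (c \in s) => /=.
  rewrite obs_rcons_old// eqseq_rcons andbF.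
  apply/negbTE/negP => /andP[/eqP e /eqP rj].
  have : rank s c \in obs s by apply: map_f.
  by rewrite e rj => /mapP[x _ /eqP]; rewrite (negbTE (neq_bump r x)).
rewrite obs_rcons_new// eqseq_rcons.
have [->|] := eqVneq (rank s c) r; rewrite ?andbF// !andbT.
by apply/eqP/eqP => [/inj_map|->//]; apply; exact: can_inj (bumpK r).
Qed.

Local Open Scope ring_scope.

(** Law of total probability over the next object: each order observing [h] falls into exactly one
    of the [k] old and [k.+1] new extensions. *)
Lemma sum_observing (V : nmodType) (X : T.-tuple ('I_n * 'I_m) -> V) k h :
  ranked k h -> (size h < T)%N ->
  \sum_(w in observing m n h) X w =
  \sum_(j < k) \sum_(w in observing m n (rcons h j)) X w +
  \sum_(r < k.+1) \sum_(w in observing m n (newcomer h r)) X w.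
Proof.
move=> hk hT; rewrite big_mkcond.
under [X in _ = X + _]eq_bigr do rewrite big_mkcond.
under [X in _ = _ + X]eq_bigr do rewrite big_mkcond.
rewrite [X in _ = X + _]exchange_big [X in _ = _ + X]exchange_big -big_split/=.
apply: eq_bigr => w _.
under [X in _ = X + _]eq_bigr => j _ do rewrite (mem_observing_old w hk hT (ltn_ord j)).
under [X in _ = _ + X]eq_bigr => r _ do rewrite mem_observing_new//.
case: (boolP (w \in observing m n h)) => wh /=; last by rewrite !big1 ?addr0.
set s := take _ _; set c := nth _ _ _.
have sk : size (undup s) = k := observing_size hk wh.
have sum1 (l a : nat) : (a < l)%N -> \sum_(j < l) (if a == j then X w else 0) = X w.
  move=> al; rewrite -big_mkcond (big_pred1 (Ordinal al)) => // j; rewrite /= eq_sym.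
have [cs|cs] /= := boolP (c \in s).
  by rewrite sum1 ?big1 ?addr0// -sk rank_ltn_size.
by rewrite sum1 ?big1 ?add0r// ltnS -sk rank_leq_size.
Qed.

End Children.

(** * Backward induction *)

Local Open Scope ring_scope.

Section Value.
Context {R : realType} (m n : nat).

(* Recursion on [d = n - k] unseen candidates and, inside, on [e = m - i] missing
   copies of the maximal candidate; [x] is [k / n], and [b] counts the unseen
   objects.  Objects of other inspected candidates do not change the state, so
   they are left out. *)
Fixpoint value_col (x b : R) (f : nat -> R) (e : nat) : R :=
  if e is e'.+1 then
    (e%:R * (if e' is 0 then x else value_col x b f e') + b * f e) / (e%:R + b)
  else f 0%N.

Fixpoint value_rev (d : nat) : nat -> R :=
  value_col ((n - d)%:R / n%:R) (m * d)%:R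
    (if d is d'.+1 then fun e =>
       (value_rev d' m.-1 + (n - d)%:R * value_rev d' e) / (n - d).+1%:R
     else fun=> 0).

Definition value (k i : nat) : R := value_rev (n - k) (m - i).

(** The value when the [i]-th copy of the maximal candidate has just been inspected: for [i = m] it
    is nice and gets accepted, with chance [k / n]. *)
Definition reach (k i : nat) : R := if i == m then k%:R / n%:R else value k i.

(** The next object that matters is one of the [m - i] missing copies of the maximal candidate or
    one of the [m * (n - k)] unseen objects; a newcomer becomes maximal with probability
    [1 / (k + 1)]. Without division the identity also covers the case of no such object. *)
Lemma value_rec k i : (k <= n)%N ->
  ((m - i)%:R + (m * (n - k))%:R) * value k i =
  (m - i)%:R * reach k i.+1 + (m * (n - k))%:R *
    ((value k.+1 1 + k%:R * value k.+1 i) / k.+1%:R).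
Proof.
move=> kn; have kE : (n - (n - k) = k)%N by lia.
have [mi|im] := leqP m i.
  rewrite (_ : m - i = 0)%N ?add0r ?mul0r ?add0r; last by lia.
  rewrite /value (_ : m - i = 0)%N; last by lia.
  case dE : (n - k)%N => [|d]; first by rewrite muln0 !mul0r.
  congr (_ * _).
  by rewrite /= -dE kE (_ : n - k.+1 = d)%N ?subn1//; lia.
have b0 : (m - i)%:R + (m * (n - k))%:R != 0 :> R.
  by rewrite -natrD pnatr_eq0 -lt0n addn_gt0 subn_gt0 im.
case eE : (m - i)%N b0 => [|e] b0; first by lia.
have reE : reach k i.+1 = if e is 0 then k%:R / n%:R else value_rev (n - k) e.
  rewrite /reach; case: e eE {b0} => [|e] eE; first by rewrite ifT//; lia.
  by rewrite ifF /value; [congr value_rev; lia|lia].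
rewrite reE /value eE; case dE : (n - k)%N b0 => [|d] b0.
  by rewrite /= muln0 !mul0r !addr0 mulrC divfK -?dE ?kE//; rewrite muln0 addr0 in b0.
rewrite (_ : n - k.+1 = d)%N; last by lia.
rewrite /= -/value_rev -dE kE subn1 mulrC divfK//.
Qed.

Lemma value_end i : (m <= i)%N -> value n i = 0.
Proof. by move=> mi; rewrite /value subnn (_ : m - i = 0)%N//; lia. Qed.

Lemma value_last k : (0 < m)%N -> (k < n)%N ->
  value k m = (value k.+1 1 + k%:R * value k.+1 m) / k.+1%:R.
Proof.
move=> m0 kn; have := value_rec m (ltnW kn).
rewrite subnn add0r mul0r add0r; apply: mulfI.
by rewrite pnatr_eq0 -lt0n muln_gt0 m0 subn_gt0.
Qed.

(* For [i < m] the function [(m + k/n) / (m + 1)] of the state [(k, i)] is a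
   subsolution of the recursion, with equality for [i = m - 1]. *)
Lemma value_lb k i : (1 < m)%N -> (0 < n)%N -> (k <= n)%N -> (i < m)%N ->
  (m%:R + k%:R / n%:R) / m.+1%:R <= value k i.
Proof.
move=> m1 n0 kn im.
have n0' : n%:R != 0 :> R by rewrite pnatr_eq0 -lt0n.
have n0R : 0 < n%:R :> R by rewrite ltr0n.
have m0R : 0 < m.+1%:R :> R by rewrite ltr0n.
pose L (j : nat) : R := (m%:R + j%:R / n%:R) / m.+1%:R.
have LS j : L j.+1 = L j + (n%:R * m.+1%:R)^-1.
  by rewrite /L -natr1 invfM; field; rewrite n0' ?nat1r ?natr1 (gt_eqF m0R).
rewrite -/(L k).
have [d dE] : exists d, (n - k)%N = d by exists (n - k)%N.
elim: d k kn dE i im => [|d IHd] k kn dE i im.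
all: have [e eE] : exists e, (m - i)%N = e.+1 by exists (m - i).-1; lia.
all: elim: e i eE im => [|e IHe] i eE im.
all: have := value_rec i kn; rewrite dE eE.
(* With no unseen candidate and one copy missing, the value and [L n] are both 1. *)
- rewrite (_ : k = n); last by lia.
  rewrite muln0 mul0r !addr0 /reach ifT; last by lia.
  move=> /mulfI -> //; rewrite ?oner_eq0//.
  rewrite /L divff// -natr1 divff// natr1 (gt_eqF m0R)//.
- rewrite muln0 mul0r !addr0 /reach ifF; last by lia.
  move=> /mulfI ->; first by apply: IHe; lia.
  by rewrite pnatr_eq0.
all: have k1n : (k.+1 <= n)%N by lia.
all: have dE1 : (n - k.+1 = d)%N by lia.
all: have v1 := IHd _ k1n dE1 1%N m1; have vi := IHd _ k1n dE1 _ im.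
(* The value after a newcomer is an average, with weights 1 and [k], of two values bounded below by
   [L k.+1]. *)
all: have avg : L k.+1 <= (value k.+1 1 + k%:R * value k.+1 i) / k.+1%:R by
  rewrite ler_pdivlMr ?ltr0n// -natr1 mulrDr mulr1 addrC lerD// mulrC ler_wpM2l.
all: have bk : (m * d.+1)%:R = m%:R * (n%:R - k%:R) :> R by
  rewrite -natrB// natrM; congr (_ * _%:R); lia.
- rewrite /reach ifT; last by lia.
  move=> vE; have := ler_wpM2l (ler0n R (m * d.+1)) avg.
  have LE : k%:R / n%:R + (m * d.+1)%:R * L k.+1 = (1 + (m * d.+1)%:R) * L k.
    by rewrite LS bk /L -natr1; field; rewrite n0' ?nat1r ?natr1 (gt_eqF m0R).
  rewrite -(lerD2l (1 * (k%:R / n%:R))) -vE mul1r LE ler_pM2l//.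
- rewrite /reach ifF; last by lia.
  have im1 : (i.+1 < m)%N by lia.
  have eE1 : (m - i.+1 = e.+1)%N by lia.
  have ei := IHe _ eE1 im1.
  (* As [L] increases, both terms of the recursion are bounded below by [L k] when more than one
     copy is missing. *)
  have LL : L k <= L k.+1 by rewrite LS lerDl invr_ge0 mulr_ge0.
  move=> vE; have := lerD (ler_wpM2l (ler0n R e.+2) ei)
    (ler_wpM2l (ler0n R (m * d.+1)) (le_trans LL avg)).
  rewrite -vE -mulrDl ler_pM2l// ltr_pwDl// ltr0n//.
Qed.

(** Follows from [x <= (m + x) / (m + 1)] for [x <= 1]. Accepting a copy of the maximal candidate
    before its last one is thus never better than waiting. *)
Lemma value_ge_best k i : (1 < m)%N -> (0 < n)%N -> (k <= n)%N -> (i < m)%N ->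
  k%:R / n%:R <= value k i.
Proof.
move=> m1 n0 kn im; apply: le_trans (value_lb m1 n0 kn im).
rewrite ler_pdivlMr ?ltr0n// -natr1 mulrDr mulr1 lerD2r.
by rewrite ler_piMl// ler_pdivrMr ?ltr0n// mul1r ler_nat.
Qed.

Lemma value_last_ge0 k : (1 < m)%N -> (0 < n)%N -> (k <= n)%N -> 0 <= value k m.
Proof.
move=> m1 n0 kn; have [d dE] : exists d, (n - k)%N = d by exists (n - k)%N.
elim: d k kn dE => [|d IHd] k kn dE.
  by rewrite (_ : k = n) ?value_end//; lia.
rewrite value_last; [|lia|lia].
rewrite divr_ge0 ?addr_ge0 ?mulr_ge0 ?IHd//; try lia.
by apply: le_trans (value_ge_best m1 n0 _ m1); rewrite ?divr_ge0//; lia.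
Qed.

End Value.

(** * Values of histories and payoffs of strategies *)

Section DynamicProgramming.
Context {R : realType} (m n : nat).
Hypothesis m1 : (1 < m)%N.
Notation T := (m * n)%N.
Implicit Types (w : T.-tuple ('I_n * 'I_m)) (s h : seq nat) (sigma : strategy).

Let N h : R := #|observing m n h|%:R.

Definition state_value h : R :=
  value m n (size (undup h)) (count_mem (maximal h) h).

(* The probability of success of accepting nice candidates, seen from the
   moment when the last object of [h] is inspected but not yet decided upon;
   in [state_value] it has already been rejected. *)
Definition arrival_value h : R :=
  if nice m h then (size (undup h))%:R / n%:R else state_value h.

Lemma state_valueE k h : (0 < k)%N -> ranked k h ->
  state_value h = value m n k (count_mem k.-1 h).
Proof. by move=> k0 hk; rewrite /state_value (ranked_size hk) (ranked_maximal k0 hk). Qed.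

Lemma arrival_valueE k h : (0 < k)%N -> ranked k h -> (0 < size h)%N ->
  arrival_value h = if (last 0%N h == k.-1) && (count_mem k.-1 h == m)
    then k%:R / n%:R else value m n k (count_mem k.-1 h).
Proof.
move=> k0 hk h0; rewrite /arrival_value /nice h0 (state_valueE k0 hk).
by rewrite (ranked_size hk) (ranked_maximal k0 hk).
Qed.

Lemma arrival_value_old k h j : ranked k h -> (j < k)%N ->
  arrival_value (rcons h j) = if j == k.-1 then reach m n k (count_mem k.-1 h).+1
    else value m n k (count_mem k.-1 h).
Proof.
move=> hk jk; have k0 : (0 < k)%N by lia.
rewrite (arrival_valueE k0 (ranked_old hk jk)) ?size_rcons// last_rcons.
rewrite -cats1 count_cat /= addn0; case: eqP => [_|_]/=; last by rewrite addn0.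
by rewrite addn1.
Qed.

(** Only a newcomer of rank [k] becomes maximal, and as [1 < m] its first copy is not nice;
    otherwise the maximal candidate keeps its count under the new rank [k]. *)
Lemma arrival_value_new k h r : (0 < k)%N -> ranked k h -> (r <= k)%N ->
  arrival_value (newcomer h r) = if r == k then value m n k.+1 1
    else value m n k.+1 (count_mem k.-1 h).
Proof.
move=> k0 hk rk; rewrite (arrival_valueE _ (ranked_new hk rk)) ?size_rcons//.
rewrite last_rcons /newcomer -cats1 count_cat /= addn0 count_map.
have [->|rk'] := eqVneq r k.
  rewrite (_ : count _ h = 0%N) ?add0n ?(ltn_eqF m1)//.
  apply/eqP; rewrite -[_ == _]negbK -lt0n -has_count; apply/negP.
  by move=> /hasP[x _ /= /eqP e]; have := neq_bump k x; rewrite e eqxx.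
rewrite addn0; congr value; apply: eq_in_count => x; rewrite hk => xk /=.
rewrite /bump; lia.
Qed.

Lemma observing_bounds k h : ranked k h -> (size h <= T)%N -> N h != 0 ->
  (k <= n)%N /\ forall x, (count_mem x h <= m)%N.
Proof.
move=> hk hT; rewrite /N (card_observing hk hT) pnatr_eq0 muln_eq0 negb_or.
rewrite -lt0n bin_gt0 => /andP[kn]; rewrite -lt0n => /card_gt0P[w].
rewrite mem_prefixed => /andP[wo /eqP wh]; split=> // x.
have [xn|nx] := ltnP x n; last first.
  by rewrite (count_memPn _)// hk; lia.
by rewrite -(count_cands wo xn) -[X in (_ <= count_mem x X)%N](cat_take_drop (size h)) wh count_cat leq_addr.
Qed.

(** The value of a rejected history is the conditional expectation of the arrival value after one
    more object, here weighted by numbers of orders. *)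
Lemma state_value_harmonic k h : (0 < k)%N -> ranked k h -> (size h < T)%N ->
  N h * state_value h =
  \sum_(j < k) N (rcons h j) * arrival_value (rcons h j) +
  \sum_(r < k.+1) N (newcomer h r) * arrival_value (newcomer h r).
Proof.
case: k => // k k0 hk hT; have T0 : (T - size h)%:R != 0 :> R by rewrite pnatr_eq0; lia.
apply: (mulfI T0).
have oldE j : (j < k.+1)%N ->
    (T - size h)%:R * N (rcons h j) = (m - count_mem j h)%:R * N h.
  by move=> jk; rewrite -!natrM (card_observing_old hk hT jk).
have newE r : (r < k.+2)%N ->
    (T - size h)%:R * N (newcomer h r) = (m * (n - k.+1))%:R * N h / k.+2%:R.
  rewrite ltnS => rk; apply: (canRL (mulfK _)); first by rewrite pnatr_eq0.
  by rewrite -!natrM -(card_observing_new hk hT rk) mulnA mulnAC.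
have NE : (T - size h)%:R * N h =
    \sum_(j < k.+1) (m - count_mem (j : nat) h)%:R * N h + (m * (n - k.+1))%:R * N h.
  rewrite {1}/N -sumr_const (sum_observing (fun=> 1) hk hT) mulrDr.
  congr (_ + _); rewrite mulr_sumr.
    by apply: eq_bigr => j _; rewrite -oldE// sumr_const.
  under eq_bigr => r _ do rewrite sumr_const newE//.
  by rewrite sumr_const card_ord -[LHS]mulr_natr divfK// pnatr_eq0.
(* A history with more than [n] candidates is impossible, so all weights vanish. *)
have [nk|kn] := ltnP n k.+1.
  have N0 : N h = 0.
    by apply/eqP/negPn/negP => /(observing_bounds hk (ltnW hT))[]; lia.
  rewrite N0 mul0r mulr0 mulrDr !mulr_sumr !big1 ?addr0// => j _.
    by rewrite mulrA newE// N0 mulr0 !mul0r.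
  by rewrite mulrA oldE// N0 mulr0 mul0r.
rewrite mulrA NE (state_valueE k0 hk) mulrDr !mulr_sumr.
have rec := value_rec (R := R) m (count_mem k h) kn.
set i := count_mem k h in rec *; set v := value m n k.+1 i in rec *.
under [X in _ = X + _]eq_bigr => j _.
  rewrite mulrA oldE// (arrival_value_old hk (ltn_ord j)) -/i -/v.
over.
under [X in _ = _ + X]eq_bigr => r _.
  rewrite mulrA newE// (arrival_value_new k0 hk (ltn_ord r)) -/i.
over.
rewrite big_ord_recr [X in _ = X + _]big_ord_recr [X in _ = _ + X]big_ord_recr/=.
rewrite !eqxx -/i.
under [X in _ = X + _ + _]eq_bigr => j _ do rewrite ltn_eqF//.
under [X in _ = _ + (X + _)]eq_bigr => j _ do rewrite ltn_eqF//.
rewrite -!mulr_suml sumr_const card_ord -[(_ * _)%:R *+ _]mulr_natr.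
(* [D] counts the missing copies of the inspected candidates that are not maximal. They leave the
   value unchanged, so their share cancels and [value_rec] remains. *)
set D := \sum_(_ < k) _.
have k20 : k.+2%:R != 0 :> R by rewrite pnatr_eq0.
apply: (@addIr _ (- (D * N h * v))).
transitivity (N h * (((m - i)%:R + (m * (n - k.+1))%:R) * v)); first by ring.
by rewrite rec; field; rewrite ?nat1r ?natr1.
Qed.

(** An object that is not maximal when inspected cannot be the best overall, so accepting it never
    wins. *)
Lemma last_best k h w : (0 < n)%N -> (0 < size h)%N -> (size h <= T)%N ->
  ranked k h -> w \in observing m n h ->
  nth 0%N (cands w) (size h).-1 == n.-1 -> last 0%N h = k.-1.
Proof.
move=> n0 h0 hT hk wh; have sk := observing_size hk wh.
move: wh; rewrite mem_observing => /andP[_ /eqP wh].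
set s := take _ _ in sk wh.
have ss : size s = size h by rewrite /s size_takel// size_cands.
have -> : nth 0%N (cands w) (size h).-1 = last 0%N s.
  by rewrite -nth_last ss /s nth_take// prednK.
have ls : last 0%N s \in s.
  by case: (s) ss h0 => [<-//|x s'] _ _ /=; rewrite mem_last.
have -> : last 0%N h = rank s (last 0%N s).
  by rewrite -wh obsE; case: (s) ls => //= x s' _; rewrite last_map.
move=> /eqP ln; have k0 : (0 < k)%N.
  by move: (hk (last 0%N h)); case: (h) h0 => //= x h1 _; rewrite mem_last; lia.
have : k.-1 \in obs s by rewrite wh hk; lia.
rewrite obsE => /mapP[y ys yE]; rewrite yE; congr rank; apply/eqP.
have yn : (y < n)%N by apply: (@cands_ltn m n w); exact: mem_take ys.
have := rank_ltn_size ls; rewrite sk.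
have [yl|yl|//] := ltngtP y (last 0%N s); last by lia.
by have := rank_lt ys yl; lia.
Qed.

Lemma wins_step sigma s t : (t < size s)%N ->
  wins n sigma s t = if sigma (obs (take t.+1 s)) then nth 0%N s t == n.-1
                     else wins n sigma s t.+1.
Proof.
move=> ts; rewrite /wins -[(size s - t)%N]prednK ?subn_gt0//= -subnS.
by case: ifP.
Qed.

(** Number of orders observing [h] in which [sigma] wins after all of [h] has been rejected; in
    [arrival_payoff] the last object of [h] is still to be decided upon. *)
Definition payoff sigma h : R :=
  \sum_(w in observing m n h) (wins n sigma (cands w) (size h))%:R.

Definition arrival_payoff sigma h : R :=
  if sigma h then
    #|[set w in observing m n h | nth 0%N (cands w) (size h).-1 == n.-1]%SET|%:R
  else payoff sigma h.

Lemma payoff_step sigma k h : ranked k h -> (size h < T)%N ->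
  payoff sigma h = \sum_(j < k) arrival_payoff sigma (rcons h j) +
                   \sum_(r < k.+1) arrival_payoff sigma (newcomer h r).
Proof.
move=> hk hT.
(* All orders observing [h'] show the strategy the same history, so they share the decision
   [sigma h']. *)
have stepE h' : size h' = (size h).+1 ->
    \sum_(w in observing m n h') (wins n sigma (cands w) (size h))%:R =
    arrival_payoff sigma h' :> R.
  move=> h'h; rewrite /arrival_payoff /payoff; case: ifP => sh.
    rewrite -sum1_card natr_sum [RHS]big_mkcond [LHS]big_mkcond; apply: eq_bigr => w _.
    rewrite [in RHS]finset.in_set; case: (boolP (w \in observing m n h')) => //=.
    rewrite mem_observing => /andP[_ /eqP wh'].
    by rewrite wins_step ?size_cands// -h'h wh' sh h'h /=; case: eqP.
  apply: eq_bigr => w; rewrite mem_observing => /andP[_ /eqP wh'].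
  by rewrite wins_step ?size_cands// -h'h wh' sh.
rewrite /payoff (sum_observing _ hk hT); congr (_ + _); apply: eq_bigr => j _.
  by rewrite stepE// size_rcons.
by rewrite stepE// size_rcons size_map.
Qed.

Lemma payoff_end sigma h : (T <= size h)%N -> payoff sigma h = 0.
Proof.
move=> Th; rewrite /payoff big1// => w _; rewrite /wins size_cands.
by rewrite (eqP Th).
Qed.

(** When everything has been inspected, a possible history is in state [(n, m)], whose value is
    0. *)
Lemma state_value_end k h : (0 < k)%N -> ranked k h -> size h = T ->
  N h * state_value h = 0.
Proof.
move=> k0 hk hT; have [->|N0] := eqVneq (N h) 0; first by rewrite mul0r.
have : (0 < #|observing m n h|)%N by rewrite -(ltr0n R) lt0r N0 ler0n.
move=> /card_gt0P[w]; rewrite mem_observing hT take_oversize ?size_cands//.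
move=> /andP[wo /eqP wh].
have wr : ranked n (cands w).
  move=> x; apply/idP/idP => [|xn]; first exact: cands_ltn.
  by rewrite -has_pred1 has_count (count_cands wo xn); lia.
have n0 : (0 < n)%N.
  by case: (posnP n) hT => // n0; rewrite {1}n0 muln0 => /size0nil h0; move: (hk 0%N); rewrite h0 k0.
rewrite /state_value -wh (obs_id wr) (ranked_size wr) (ranked_maximal n0 wr).
by rewrite (count_cands wo) ?prednK// value_end// mulr0.
Qed.

(** Induction on the number of objects left: payoff and value satisfy the same recursion, and an
    accepted nice object wins with probability [k / n] by [card_observing_best]. *)
Lemma payoff_nice k h : (0 < k)%N -> ranked k h -> (size h <= T)%N ->
  payoff (nice m) h = N h * state_value h.
Proof.
move=> k0 hk hT; have [d dE] : exists d, (T - size h)%N = d by exists (T - size h)%N.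
elim: d k h k0 hk hT dE => [|d IHd] k h k0 hk hT dE.
  have hE : size h = T by lia.
  by rewrite (state_value_end k0 hk hE) payoff_end ?hE.
have hT' : (size h < T)%N by lia.
have childE k' h' : (0 < k')%N -> ranked k' h' -> size h' = (size h).+1 ->
    arrival_payoff (nice m) h' = N h' * arrival_value h'.
  move=> k'0 hk' h'h; rewrite /arrival_payoff /arrival_value.
  case: ifP => nh; last by rewrite (IHd k')//; lia.
  have [n0|n0] := posnP n; first by lia.
  rewrite (ranked_size hk') mulrA; apply: (canRL (mulfK _)).
    by rewrite pnatr_eq0 -lt0n.
  rewrite -!natrM mulnC (card_observing_best k'0 n0 hk') 1?mulnC//; first lia.
  by move: nh => /and3P[_ /eqP -> _]; rewrite (ranked_maximal k'0 hk').
rewrite (payoff_step _ hk hT') (state_value_harmonic k0 hk hT').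
congr (_ + _); apply: eq_bigr => j _.
  by apply: (childE k); rewrite ?size_rcons//; apply: ranked_old.
apply: (childE k.+1); rewrite ?size_rcons ?size_map//.
by apply: ranked_new; rewrite // -ltnS.
Qed.

(** The number of inspected candidates never decreases, so the bound from [k0] on applies to every
    later history. *)
Lemma payoff_le sigma k0 k h : (0 < k0 <= k)%N -> ranked k h -> (size h <= T)%N ->
  (forall l, (k0 <= l <= n)%N -> value m n l m <= l%:R / n%:R :> R) ->
  payoff sigma h <= N h * state_value h.
Proof.
move=> kk hk hT opt.
have [d dE] : exists d, (T - size h)%N = d by exists (T - size h)%N.
elim: d k h kk hk hT dE => [|d IHd] k h kk hk hT dE.
  have hE : size h = T by lia.
  have kp : (0 < k)%N by lia.
  by rewrite (state_value_end kp hk hE) payoff_end ?hE.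
have hT' : (size h < T)%N by lia.
have childE k' h' : (k0 <= k')%N -> ranked k' h' -> size h' = (size h).+1 ->
    arrival_payoff sigma h' <= N h' * arrival_value h'.
  move=> kk' hk' h'h; have h'T : (size h' <= T)%N by lia.
  have k'0 : (0 < k')%N by lia.
  have [N0|N0] := eqVneq (N h') 0.
    rewrite N0 mul0r /arrival_payoff /payoff.
    have /eqP/cards0_eq -> : #|observing m n h'| == 0%N by rewrite -(eqr_nat R) -/(N h') N0.
    case: ifP => _; last by rewrite big1// => w; rewrite finset.in_set0.
    rewrite (_ : [set w in _ | _]%SET = finset.set0) ?cards0//.
    by apply/setP => w; rewrite !finset.in_set.
  have [k'n cm] := observing_bounds hk' h'T N0.
  have n0 : (0 < n)%N by lia.
  have Np : 0 <= N h' by rewrite ler0n.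
  rewrite (arrival_valueE k'0 hk') ?h'h//.
  rewrite /arrival_payoff; case: ifP => _.
    set c := #|_|.
    (* If [sigma] accepts an object that is not maximal, it cannot win, while the arrival value is
       nonnegative. *)
    have [ln|ln] := eqVneq (last 0%N h') k'.-1; last first.
      rewrite /= (_ : c = 0%N); last first.
        apply/eqP/negPn/negP; rewrite -lt0n => /card_gt0P[w].
        rewrite finset.in_set => /andP[wh' /(last_best n0 _ h'T hk' wh')].
        by rewrite h'h => /(_ isT) /eqP; rewrite (negbTE ln).
      apply: mulr_ge0 => //; have := cm k'.-1; rewrite leq_eqVlt => /orP[/eqP ->|im].
        exact: value_last_ge0.
      by apply: le_trans (value_ge_best m1 n0 k'n im); rewrite divr_ge0.
    (* An accepted copy of the maximal candidate wins with probability [k' / n]: equal to the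
       arrival value for the last copy, at most that value for an earlier one. *)
    have -> : c%:R = N h' * (k'%:R / n%:R) :> R.
      rewrite mulrA; apply: (canRL (mulfK _)); first by rewrite pnatr_eq0 -lt0n.
      rewrite -!natrM mulnC (card_observing_best k'0 n0 hk' h'T)// mulnC//.
    rewrite ler_wpM2l//=; case: ifPn => // cn.
    by apply: value_ge_best => //; rewrite ltn_neqAle cn cm.
  (* If [sigma] rejects, induction bounds its payoff; should the object be nice, [opt] says that
     rejecting it gains nothing. *)
  apply: le_trans (IHd k' h' _ hk' h'T _) _; [lia|lia|].
  rewrite (state_valueE k'0 hk') ler_wpM2l//; case: ifP => // /andP[_ /eqP ->].
  by apply: opt; rewrite kk' k'n.
rewrite (payoff_step _ hk hT') (state_value_harmonic _ hk hT'); last by lia.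
apply: lerD; apply: ler_sum => j _.
  by apply: (childE k); rewrite ?size_rcons//; [lia|apply: ranked_old].
apply: (childE k.+1); rewrite ?size_rcons ?size_map//; first lia.
by apply: ranked_new; rewrite // -ltnS.
Qed.

End DynamicProgramming.

(** * From histories to states *)

Local Open Scope nat_scope.

Lemma obs_take t s : obs (take t s) = obs (take t (obs s)).
Proof.
rewrite [obs s]obsE -map_take obs_map// => x y xs ys.
by apply: rank_mono; [exact: mem_take xs|exact: mem_take ys].
Qed.

(** The state is a function of the observation; this makes [entry] a stopping time. *)
Lemma in_state_obs k i s : in_state k i (obs s) = in_state k i s.
Proof.
have hk := obs_ranked s; rewrite /in_state (ranked_size hk).
case: s hk => // a s0; set s := a :: s0 => hk.
have k0 : 0 < size (undup s) by apply: leq_ltn_trans (rank_ltn_size (mem_head a s0)).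
rewrite (ranked_maximal k0 hk); congr (_ && (_ == _)).
have : (size (undup s)).-1 \in obs s by rewrite hk prednK.
rewrite obsE => /mapP[y ys yE].
have -> : maximal s = y.
  apply/eqP; rewrite eqn_leq; apply/andP; split; last first.
    exact: (@leq_bigmax_seq _ s xpredT id _ ys).
  apply/bigmax_leqP_seq => x xs _; rewrite leqNgt; apply/negP => /(rank_lt ys).
  by rewrite -yE; have := rank_ltn_size xs; lia.
rewrite yE count_map; apply: eq_in_count => x xs /=.
by apply/eqP/eqP => [/(rank_inj xs ys)|->].
Qed.

Lemma entryP k i s : has (state_at k i s) (iota 0 (size s).+1) ->
  [/\ entry k i s <= size s, state_at k i s (entry k i s) &
      forall u, u < entry k i s -> ~~ state_at k i s u].
Proof.
move=> hs; have := hs; rewrite has_find size_iota ltnS => es; split => //.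
  by have := nth_find 0 hs; rewrite nth_iota// ltnS.
move=> u ue; have := before_find 0 ue; rewrite nth_iota ?add0n; first by move=> ->.
by rewrite ltnS; apply: leq_trans (ltnW ue) es.
Qed.

Lemma entry_leq k i s u : u <= size s -> state_at k i s u ->
  has (state_at k i s) (iota 0 (size s).+1) /\ entry k i s <= u.
Proof.
move=> us su; have hs : has (state_at k i s) (iota 0 (size s).+1).
  by apply/hasP; exists u; rewrite // mem_iota add0n ltnS.
split=> //; have [_ _ ne] := entryP hs.
by rewrite leqNgt; apply/negP => /ne; rewrite su.
Qed.

Section Success.
Context {R : realType} (m n : nat).
Notation T := (m * n).
Implicit Types (w : T.-tuple ('I_n * 'I_m)).

Definition entry_obs k i w : seq nat :=
  obs (take (entry k i (cands w)) (cands w)).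

Lemma mem_visiting k i w : (w \in visiting m n k i) = (w \in orders m n) &&
  has (state_at k i (cands w)) (iota 0 (size (cands w)).+1).
Proof. by rewrite finset.in_set. Qed.

Lemma size_entry_obs k i w : w \in visiting m n k i ->
  size (entry_obs k i w) = entry k i (cands w).
Proof.
rewrite mem_visiting => /andP[_ /entryP[es _ _]].
by rewrite size_obs size_takel.
Qed.

(** An order that agrees with [w] in the observation up to the entry time passes through the same
    states up to then, so it enters [(k, i)] at the same moment. *)
Lemma observing_entry k i w w' : w \in visiting m n k i ->
  w' \in observing m n (entry_obs k i w) ->
  [/\ w' \in visiting m n k i, entry k i (cands w') = entry k i (cands w) &
      entry_obs k i w' = entry_obs k i w].
Proof.
move=> wv; have := wv; rewrite mem_visiting mem_observing (size_entry_obs wv).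
move=> /andP[_ /entryP[es se ne]] /andP[w'o /eqP ww'].
set t := entry k i (cands w) in es se ne ww' *.
have tT : t <= size (cands w') by rewrite !size_cands in es *.
have same u : u <= t -> state_at k i (cands w') u = state_at k i (cands w) u.
  move=> ut; rewrite /state_at -in_state_obs -[RHS]in_state_obs.
  rewrite -(take_takel (cands w') ut) -(take_takel (cands w) ut).
  by rewrite obs_take ww' [in RHS]obs_take.
have [hs' e't] : has (state_at k i (cands w')) (iota 0 (size (cands w')).+1) /\
    entry k i (cands w') <= t.
  by apply: entry_leq => //; rewrite same.
have [_ se' _] := entryP hs'.
have ee : entry k i (cands w') = t.
  apply/eqP; rewrite eqn_leq e't/= leqNgt; apply/negP => lt.
  by have := ne _ lt; rewrite -same ?se'// ltnW.
split=> //; first by rewrite mem_visiting w'o.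
by rewrite /entry_obs ee.
Qed.

(** By [observing_entry], the orders visiting [(k, i)] split into full classes [observing h], one
    for each history [h] of entry. *)
Lemma sum_visiting (V : nmodType) (X : T.-tuple ('I_n * 'I_m) -> V) k i :
  let key w := observing m n (entry_obs k i w) in
  (\sum_(w in visiting m n k i) X w =
  \sum_(B in [set key w | w in visiting m n k i]%SET) \sum_(w in B) X w)%R.
Proof.
move=> key; rewrite (partition_big_imset key)/=; apply: eq_bigr => B.
move=> /imsetP[w wv ->]; apply: eq_bigl => w'; apply/andP/idP => [[w'v /eqP <-]|].
  rewrite /key mem_observing size_entry_obs//; apply/andP; split => //.
  by move: w'v; rewrite mem_visiting => /andP[].
by move=> /(observing_entry wv)[-> _ e]; rewrite /key e.
Qed.

Local Open Scope ring_scope.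

Lemma entry_obs_value k i w : (0 < k)%N -> w \in visiting m n k i ->
  ranked k (entry_obs k i w) /\
  state_value m n (entry_obs k i w) = value m n k i :> R.
Proof.
move=> k0; rewrite mem_visiting => /andP[_ /entryP[_ se _]].
have := se; rewrite /state_at -in_state_obs -/(entry_obs k i w).
rewrite /in_state /state_value => /andP[/eqP -> /eqP ->]; split => //.
move: se => /andP[/eqP sk _].
by have := obs_ranked (take (entry k i (cands w)) (cands w)); rewrite sk.
Qed.

Lemma card_winning k i sigma : #|winning m n k i sigma|%:R =
  \sum_(w in visiting m n k i)
    (wins n sigma (cands w) (entry k i (cands w)))%:R :> R.
Proof.
rewrite -sumr_const big_mkcond [RHS]big_mkcond; apply: eq_bigr => w _.
by rewrite finset.in_set; case: (w \in _) => //=; case: (wins _ _ _ _).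
Qed.

Lemma sum_payoff k i sigma w : w \in visiting m n k i ->
  \sum_(w' in observing m n (entry_obs k i w))
    (wins n sigma (cands w') (entry k i (cands w')))%:R =
  payoff m n sigma (entry_obs k i w) :> R.
Proof.
move=> wv; apply: eq_bigr => w' /(observing_entry wv)[_ -> _].
by rewrite (size_entry_obs wv).
Qed.

Lemma size_entry_obs_leq k i w : w \in visiting m n k i ->
  (size (entry_obs k i w) <= T)%N.
Proof.
move=> wv; rewrite (size_entry_obs wv); move: wv.
by rewrite mem_visiting => /andP[_ /entryP[+ _ _]]; rewrite size_cands.
Qed.

Lemma sum_visiting_const k i (c : R) : #|visiting m n k i|%:R * c =
  \sum_(B in [set observing m n (entry_obs k i w) | w in visiting m n k i]%SET)
    #|B|%:R * c.
Proof.
rewrite -mulr_suml -sumr_const sum_visiting; congr (_ * _).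
by apply: eq_bigr => B _; rewrite sumr_const.
Qed.

(** All histories of entry have the same value, so [payoff_nice] can be summed over them. *)
Lemma winning_nice k i : (1 < m)%N -> (0 < k)%N ->
  #|winning m n k i (nice m)|%:R = #|visiting m n k i|%:R * value m n k i :> R.
Proof.
move=> m1 k0; rewrite card_winning sum_visiting sum_visiting_const.
apply: eq_bigr => B /imsetP[w wv ->]; rewrite sum_payoff//.
have [hk <-] := entry_obs_value k0 wv.
by apply: payoff_nice hk _; rewrite // size_entry_obs_leq.
Qed.

Lemma winning_leq sigma k i : (1 < m)%N -> (0 < k)%N ->
  (forall l, (k <= l <= n)%N -> value m n l m <= l%:R / n%:R :> R) ->
  #|winning m n k i sigma|%:R <= #|visiting m n k i|%:R * value m n k i :> R.
Proof.
move=> m1 k0 opt; rewrite card_winning sum_visiting sum_visiting_const.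
apply: ler_sum => B /imsetP[w wv ->]; rewrite sum_payoff//.
have [hk <-] := entry_obs_value k0 wv.
by apply: (@payoff_le _ _ _ m1 _ k k) => //; rewrite ?k0 ?leqnn// size_entry_obs_leq.
Qed.

Lemma visiting_last_gt0 k : (1 < m)%N -> (0 < k <= n)%N ->
  (0 < #|visiting m n k m|)%N.
Proof.
(* The witness starts with all copies of candidate [k.-1], followed by one copy of each worse
   candidate. *)
move=> m1 /andP[k0 kn]; pose s := nseq m k.-1 ++ iota 0 k.-1.
have sk : ranked k s.
  move=> x; rewrite mem_cat mem_nseq mem_iota; lia.
have cm : count_mem k.-1 s = m.
  rewrite count_cat count_nseq /= eqxx mul1n (count_memPn _) ?addn0//.
  by rewrite mem_iota; lia.
have /card_gt0P[w] : (0 < #|prefixed m n s|)%N.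
  apply: prefixed_gt0 => [x|x]; first by rewrite sk => xk; lia.
  have [->|xk] := eqVneq x k.-1; first by rewrite cm.
  rewrite count_cat count_nseq /= eq_sym (negbTE xk) mul0n add0n.
  by rewrite count_uniq_mem ?iota_uniq//; apply: leq_trans (leq_b1 _) (ltnW m1).
rewrite mem_prefixed => /andP[wo /eqP ws]; apply/card_gt0P; exists w.
rewrite mem_visiting wo /=.
have sT : (size s <= size (cands w))%N.
  by rewrite -{1}ws size_take; case: ltnP => // /ltnW.
apply: (entry_leq sT _).1.
by rewrite /state_at ws /in_state (ranked_size sk) (ranked_maximal k0 sk) cm !eqxx.
Qed.

(** * Comparison of the recursion with [Phi] and [Psi], and its monotonicity *)

Lemma Phi_value k : (1 < m)%N -> (0 < k <= n)%N -> Phi R m n m k = value m n k m.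
Proof.
move=> m1 kn; have := visiting_last_gt0 m1 kn; case/andP: kn => k0 _.
rewrite /Phi /success winning_nice// mulrC => v0; rewrite mulKf//.
by rewrite pnatr_eq0 -lt0n.
Qed.

Lemma Phi_le_Psi k : Phi R m n m k <= Psi R m n m k.
Proof. by have [sigma [-> +]] := Psi_attained R m n m k; apply. Qed.

Lemma Psi_le_value k : (1 < m)%N -> (0 < k <= n)%N ->
  (forall l, (k <= l <= n)%N -> value m n l m <= l%:R / n%:R :> R) ->
  Psi R m n m k <= value m n k m.
Proof.
move=> m1 kn opt; have v0 := visiting_last_gt0 m1 kn; case/andP: kn => k0 _.
have [sigma [-> _]] := Psi_attained R m n m k.
by rewrite /success ler_pdivrMr ?ltr0n// mulrC winning_leq.
Qed.

(* The recursion gives [V k / k - V l / l] as the sum of [v j / (j (j - 1))] over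
   [k < j <= l], where [V k] and [v k] are the values of the states [(k, m)] and
   [(k, 1)], and [v j >= m / (m + 1)] by [value_lb]. *)
Lemma value_ratio_le k l : (1 < m)%N -> (0 < k)%N -> (k <= l <= n)%N ->
  (value m n l m - m%:R / m.+1%:R) / l%:R <=
  (value m n k m - m%:R / m.+1%:R) / k%:R :> R.
Proof.
move=> m1 k0 /andP[kl ln].
elim: l kl ln => [|l IHl]; first by rewrite leqn0 => /eqP ->.
rewrite leq_eqVlt => /predU1P[->//|]; rewrite ltnS => kl ln.
apply: le_trans (IHl kl (ltnW ln)).
have l0 : (0 < l)%N by lia.
have n0 : (0 < n)%N by lia.
set c := _ / m.+1%:R.
have v1 : c <= value m n l.+1 1.
  apply: le_trans (value_lb m1 n0 ln m1); rewrite ler_wpM2r// lerDl.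
  by rewrite divr_ge0.
rewrite (value_last (ltnW m1) ln).
have l0R : 0 < l%:R :> R by rewrite ltr0n.
have l1R : 0 < l.+1%:R :> R by rewrite ltr0n.
(* Clearing denominators reduces the claim to [c <= value m n l.+1 1]. *)
rewrite ler_pdivlMr// mulrAC ler_pdivrMr// [leRHS]mulrBl divfK ?gt_eqF// -natr1.
by lra.
Qed.

(** This is [value_ratio_le] with [l = n], where the value is 0. *)
Lemma value_last_lb k : (1 < m)%N -> (0 < k <= n)%N ->
  m%:R / m.+1%:R * (1 - k%:R / n%:R) <= value m n k m :> R.
Proof.
move=> m1 /andP[k0 kn]; have n0 : (0 < n)%N by lia.
have := value_ratio_le m1 k0 (introT andP (conj kn (leqnn n))).
rewrite value_end// sub0r mulNr ler_pdivlMr ?ltr0n//; set c := _ / _ => H.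
have -> : c * (1 - k%:R / n%:R) = - (c / n%:R) * k%:R + c by ring.
by rewrite -lerBrDr.
Qed.

(** Writing [V k] for the value of [(k, m)], [V k / k] is the sum of [(V k - c) / k] and [c / k],
    both nonincreasing in [k]. Thus once accepting a nice candidate is optimal, it remains so. *)
Lemma value_le_mono k l : (1 < m)%N -> (0 < k)%N -> (k <= l <= n)%N ->
  value m n k m <= k%:R / n%:R :> R -> value m n l m <= l%:R / n%:R :> R.
Proof.
move=> m1 k0 kln; have := value_ratio_le m1 k0 kln.
have l0 : (0 < l)%N by lia.
have n0 : (0 < n)%N by lia.
have [k0R l0R n0R] : [/\ 0 < k%:R :> R, 0 < l%:R :> R & 0 < n%:R :> R].
  by split; rewrite ltr0n.
set c := _ / m.+1%:R; have c0 : 0 <= c by rewrite divr_ge0.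
rewrite !mulrBl => H; rewrite -ler_pdivrMl// -[_ <= l%:R / _]ler_pdivrMl//.
move=> H'; apply: le_trans H'.
rewrite ![_^-1 * _]mulrC; move: H; rewrite lerBlDr => /le_trans; apply.
rewrite -addrA gerDl addrC subr_le0 ler_wpM2l// lef_pV2 ?posrE// ler_nat.
by lia.
Qed.

End Success.

(** * The threshold in the limit *)

Local Open Scope classical_set_scope.
Local Open Scope ring_scope.

Section Limit.
Context {R : realType} (m : nat).
Hypothesis m1 : (1 < m)%N.

(** From [k] on the hypothesis of [Psi_le_value] holds, so the optimal value is bounded by the value
    of accepting nice candidates. *)
Lemma threshold_leq n k : (0 < k <= n)%N ->
  value m n k m <= k%:R / n%:R :> R -> (threshold R m n <= k)%N.
Proof.
move=> /andP[k0 kn] vk; have n0 : (0 < n)%N by lia.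
have [_ _ +] := threshold_min R m n0; apply; first by rewrite k0 kn.
apply: (le_trans (Psi_le_value m1 _ _) vk); first by rewrite k0 kn.
by move=> l ln; apply: value_le_mono vk.
Qed.

(** At the threshold [Phi <= Psi <= threshold / n], and [value_le_mono] carries this inequality to
    every larger [k]. *)
Lemma ltn_threshold n k : (0 < k <= n)%N ->
  k%:R / n%:R < value m n k m :> R -> (k < threshold R m n)%N.
Proof.
move=> /andP[k0 kn] vk; have n0 : (0 < n)%N by lia.
have [/andP[t0 tn] Pt _] := threshold_min R m n0.
rewrite ltnNge; apply/negP => tk; move: vk; rewrite ltNge => /negP; apply.
apply: (@value_le_mono _ _ _ _ _ m1 t0); first by rewrite tk kn.
rewrite -Phi_value ?t0//; exact: le_trans (Phi_le_Psi _ _ _) Pt.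
Qed.

Definition grid (x : R) (n : nat) : nat := maxn 1 (Num.truncn (x * n%:R)).

Lemma grid_bounds x n : x \in `[0, 1] -> (0 < n)%N -> (0 < grid x n <= n)%N.
Proof.
rewrite in_itv/= => /andP[x0 x1] n0; rewrite /grid leq_max /= geq_max n0/=.
rewrite -(ler_nat R) (le_trans (_ : _ <= x * n%:R)) ?truncn_le ?mulr_ge0//.
by rewrite ler_piMl.
Qed.

Lemma leq_grid x y n : x <= y -> (grid x n <= grid y n)%N.
Proof.
move=> xy; rewrite /grid geq_max leq_maxl/= leq_max; apply/orP; right.
by apply: le_truncn; rewrite ler_wpM2r.
Qed.

Lemma cvg_grid x : x \in `[0, 1] -> (grid x n)%:R / n%:R @[n --> \oo] --> x.
Proof.
rewrite in_itv/= => /andP[x0 x1]; apply/cvgrPdist_lt => e e0.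
near=> n; have en : e^-1 < n%:R by near: n; exact: nbhs_infty_gtr.
have n0 : 0 < n%:R :> R by apply: lt_trans en; rewrite invr_gt0.
have xn : 0 <= x * n%:R by rewrite mulr_ge0// ltW.
have /andP[tl tu] := truncn_itv xn.
(* The error is also at most 1 where [maxn 1] intervenes: there [0 <= x * n < 1] and the grid point
   is 1. *)
have gE : `|(grid x n)%:R - x * n%:R| <= 1.
  rewrite /grid; move: (Num.truncn _) tl tu => t; rewrite -natr1 => tl tu.
  rewrite ler_norml; case: (leqP 1 t) => t1; first by lra.
  have t0 : t = 0%N by lia.
  by rewrite t0 in tu; lra.
rewrite distrC -[x in _ - x](mulfK (lt0r_neq0 n0)) -mulrBl normrM.
rewrite normfV (gtr0_norm n0) ltr_pdivrMr//; apply: le_lt_trans gE _.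
by rewrite mulrC -ltr_pdivrMr// mul1r.
Unshelve. all: by end_near. Qed.

Lemma phi_value x n : x \in `[0, 1] -> (0 < n)%N ->
  phi m m n x = value m n (grid x n) m.
Proof. by move=> x01 n0; rewrite /phi Phi_value// grid_bounds. Qed.

Variable y : R -> R.
Hypothesis phi_cvg : forall x, x \in `[0, 1] -> phi m m n x @[n --> \oo] --> y x.

Let c : R := m%:R / m.+1%:R.

Lemma limit_lb x : x \in `[0, 1] -> c * (1 - x) <= y x.
Proof.
move=> x01; apply: ler_cvg_to (phi_cvg x01) _.
  apply: cvgMr; apply: cvgB; [exact: cvg_cst|exact: cvg_grid x01].
near=> n; have n0 : (0 < n)%N by near: n; exact: nbhs_infty_gt.
by rewrite phi_value// value_last_lb// grid_bounds.
Unshelve. all: by end_near. Qed.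

(** Limit of [value_ratio_le], multiplied out so that it includes [x = 0]. *)
Lemma limit_ratio x z : x \in `[0, 1] -> z \in `[0, 1] -> x <= z ->
  x * (y z - c) <= z * (y x - c).
Proof.
move=> x01 z01 xz.
have L : (grid x n)%:R / n%:R * (phi m m n z - c) @[n --> \oo] --> x * (y z - c).
  by apply: cvgM (cvg_grid x01) _; apply: cvgB (phi_cvg z01) _; exact: cvg_cst.
have U : (grid z n)%:R / n%:R * (phi m m n x - c) @[n --> \oo] --> z * (y x - c).
  by apply: cvgM (cvg_grid z01) _; apply: cvgB (phi_cvg x01) _; exact: cvg_cst.
apply: ler_cvg_to L U _.
near=> n; have n0 : (0 < n)%N by near: n; exact: nbhs_infty_gt.
rewrite !phi_value//.
have /andP[gx0 gxn] := grid_bounds x01 n0; have /andP[gz0 gzn] := grid_bounds z01 n0.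
have := @value_ratio_le R _ _ _ _ m1 gx0 (introT andP (conj (leq_grid n xz) gzn)).
rewrite -/c ler_pdivrMr ?ltr0n// mulrAC ler_pdivlMr ?ltr0n// => H.
rewrite mulrAC [leRHS]mulrAC ler_wpM2r ?invr_ge0//.
by rewrite mulrC [leRHS]mulrC.
Unshelve. all: by end_near. Qed.

Lemma limit_end : y 1 = 0.
Proof.
have i01 : 1 \in `[0, 1 : R] by rewrite in_itv/= ler01 lexx.
apply: cvg_unique (phi_cvg i01) _ => //; apply: cvg_near_cst.
near=> n; have n0 : (0 < n)%N by near: n; exact: nbhs_infty_gt.
rewrite phi_value// /grid mul1r natrK (maxn_idPr _)// value_end//.
Unshelve. all: by end_near. Qed.

Lemma limit_fixpoint_gt0 t : t \in `[0, 1] -> t = y t -> 0 < t.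
Proof.
move=> t01 ty; have := limit_lb t01; rewrite -ty => tl.
have c0 : 0 < c by rewrite divr_gt0 ?ltr0n// ltnW.
move: t01; rewrite in_itv/= => /andP[]; rewrite le_eqVlt => /predU1P[t0|//].
by move: tl; rewrite -t0 subr0 mulr1 leNgt c0.
Qed.

(** [limit_ratio] at [x <= t] rearranges to [t * (y x - x) >= c * (t - x) > 0]; [limit_lt] is
    symmetric. *)
Lemma limit_gt x t : x \in `[0, 1] -> t \in `[0, 1] -> t = y t -> x < t -> x < y x.
Proof.
move=> x01 t01 ty xt; have t0 := limit_fixpoint_gt0 t01 ty.
have c0 : 0 < c by rewrite divr_gt0 ?ltr0n// ltnW.
have := limit_ratio x01 t01 (ltW xt); rewrite -ty => H.
rewrite -(ltr_pM2l t0); nra.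
Qed.

Lemma limit_lt x t : x \in `[0, 1] -> t \in `[0, 1] -> t = y t -> t < x -> y x < x.
Proof.
move=> x01 t01 ty tx; have t0 := limit_fixpoint_gt0 t01 ty.
have c0 : 0 < c by rewrite divr_gt0 ?ltr0n// ltnW.
have := limit_ratio t01 x01 (ltW tx); rewrite -ty => H.
rewrite -(ltr_pM2l t0); nra.
Qed.

(** At [t - e / 2] and [t + e / 2] the strict inequalities between [y] and the diagonal pass to the
    grid points for large [n], which therefore enclose the threshold. *)
Lemma threshold_cvg t : t \in `[0, 1] -> t = y t ->
  (threshold R m n)%:R / n%:R @[n --> \oo] --> t.
Proof.
move=> t01 ty; have := t01; rewrite in_itv/= => /andP[t0 t1].
apply/cvgrPdist_lt => e e0.
have e20 : 0 < e / 2 by rewrite divr_gt0.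
have lower : \forall n \near \oo, t - e < (threshold R m n)%:R / n%:R.
  have [x0|x0] := ltP (t - e / 2) 0.
    by near=> n; apply: lt_le_trans (_ : 0 <= _); [lra|rewrite divr_ge0].
  have x01 : t - e / 2 \in `[0, 1] by rewrite in_itv/= x0/=; lra.
  have yx : t - e / 2 < y (t - e / 2) by apply: limit_gt t01 ty _ => //; lra.
  have d0 : 0 < y (t - e / 2) - (t - e / 2) by rewrite subr_gt0.
  near=> n; have n0 : (0 < n)%N by near: n; exact: nbhs_infty_gt.
  have gx : t - e < (grid (t - e / 2) n)%:R / n%:R.
    by near: n; apply: (cvgr_gt (t - e / 2) (cvg_grid x01)); lra.
  apply: lt_le_trans gx _; rewrite ler_wpM2r ?invr_ge0// ler_nat ltnW//.
  apply: ltn_threshold; first exact: grid_bounds.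
  rewrite -phi_value// -subr_gt0; near: n.
  by apply: (cvgr_gt _ (cvgB (phi_cvg x01) (cvg_grid x01))).
have upper : \forall n \near \oo, (threshold R m n)%:R / n%:R < t + e.
  have [x1|x1] := ltP 1 (t + e / 2).
    near=> n; have n0 : (0 < n)%N by near: n; exact: nbhs_infty_gt.
    apply: le_lt_trans (_ : 1 < _); last lra.
    have [/andP[_ tn] _ _] := threshold_min R m n0.
    by rewrite ler_pdivrMr ?ltr0n// mul1r ler_nat.
  have x01 : t + e / 2 \in `[0, 1] by rewrite in_itv/= x1 andbT; lra.
  have yx : y (t + e / 2) < t + e / 2 by apply: limit_lt t01 ty _ => //; lra.
  have d0 : 0 < t + e / 2 - y (t + e / 2) by rewrite subr_gt0.
  near=> n; have n0 : (0 < n)%N by near: n; exact: nbhs_infty_gt.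
  have gx : (grid (t + e / 2) n)%:R / n%:R < t + e.
    by near: n; apply: (cvgr_lt (t + e / 2) (cvg_grid x01)); lra.
  apply: le_lt_trans gx; rewrite ler_wpM2r ?invr_ge0// ler_nat.
  apply: threshold_leq; first exact: grid_bounds.
  rewrite -phi_value// -subr_ge0; near: n.
  by apply: (cvgr_ge _ (cvgB (cvg_grid x01) (phi_cvg x01))).
near=> n; rewrite ltr_distl; apply/andP; split.
  by rewrite ltrBlDr; near: n; apply: filterS upper => n; lra.
by rewrite -ltrBlDr; near: n.
Unshelve. all: by end_near. Qed.

End Limit.

Theorem theorem2 (R : realType) (m : nat) (hm : (2 <= m)%N)
    (Y : nat -> R -> R)
    (Ycvg : forall i, (1 <= i <= m)%N ->
      {uniform `[0, 1], phi m i @ \oo --> Y i})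
    (Ycont : forall i, (1 <= i <= m)%N -> {within `[0, 1], continuous (Y i)})
    (Yderiv : forall i, (1 <= i <= m)%N -> derivable_on `]0, 1] (Y i)) :
  exists theta : R,
    [/\ theta \in `[0, 1],
        theta = Y m theta,
        forall x, x \in `[0, 1] -> x = Y m x -> x = theta
      & (threshold R m n)%:R / n%:R @[n --> \oo] --> theta].
Proof.
have mm : (1 <= m <= m)%N by rewrite leqnn ltnW.
(* Uniform convergence restricted to a singleton is pointwise convergence. *)
have phi_cvg x : x \in `[0, 1] -> phi m m n x @[n --> \oo] --> Y m x.
  move=> x01; have sub : [set x] `<=` `[0, 1] by move=> _ ->.
  have := uniform_subset_cvg _ sub (Ycvg m mm); rewrite uniform_set1; apply.
(* The difference [Y m t - t] is nonnegative at 0 by [limit_lb] and equals -1 at 1 by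
   [limit_end]. *)
have [theta t01 tE] : exists2 t : R, t \in `[0, 1] & Y m t - t = 0.
  apply: IVT => //.
    move=> x; apply: cvgB; first exact: Ycont.
    by apply: (@continuous_subspaceT _ _ _ (@id R)) => z; exact: cvg_id.
  have := @limit_lb R m hm (Y m) phi_cvg 0; rewrite in_itv/= lexx ler01 => /(_ isT).
  have -> := @limit_end R m hm (Y m) phi_cvg.
  rewrite !subr0 mulr1 sub0r => y0; have y00 : 0 <= Y m 0.
    by apply: le_trans y0; rewrite divr_ge0.
  by rewrite ge_min le_max y00 lerN10 orbT.
have ty : theta = Y m theta by apply/esym/eqP; rewrite -subr_eq0 tE.
exists theta; split => //; last exact: (threshold_cvg hm phi_cvg t01 ty).
move=> x x01 xy; have [xt|tx|//] := ltgtP x theta.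
  by have := limit_gt hm phi_cvg x01 t01 ty xt; rewrite -xy ltxx.
by have := limit_lt hm phi_cvg x01 t01 ty tx; rewrite -xy ltxx.
Qed.
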